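(* Let $f:\mathbb{N}\rightarrow\mathbb{N}$ be a non-decreasing function. There exists a finitely generated group $G$ whose conjugator length function satisfies $\mathrm{Cl}_G(n)\simeq f(n)$ if and only if either $f(n)\simeq 1$ or $f(n)\succ n$. Moreover, if $f$ is computable (and satisfies either $f(n)\simeq 1$ or $f(n)\succ n$), then $G$ may be chosen to be recursively presented.
   Context: Convention: $0\in\mathbb{N}$. For a group $G$ with finite generating set $S$, $\|\cdot\|_S$ denotes the word norm on $G$ with respect to $S$. Write $g_1\sim g_2$ if $g_1,g_2$ are conjugate in $G$. For $g_1\sim g_2$ put $\mathrm{Cl}_{G,S}(g_1,g_2)=\min\{\|h\|_S : h\in G,\ hg_1h^{-1}=g_2\}$, and define the conjugator length function $$\mathrm{Cl}_{G,S}(n)=\max\{\mathrm{Cl}_{G,S}(g_1,g_2) : g_1,g_2\in G,\ g_1\sim g_2,\ \|g_1\|_S+\|g_2\|_S\le n\}.$$ For non-decreasing functions $f,g:\mathbb{N}\to\mathbb{N}$ write $f(n)\succ g(n)$ (equivalently $g\prec f$) if there exists $C\in\mathbb{N}$ such that $Cf(Cn+C)+C\ge g(n)$ for all $n\in\mathbb{N}$; write $f(n)\simeq g(n)$ if $f\prec g$ and $g\prec f$. Up to $\simeq$, $\mathrm{Cl}_{G,S}$ does not depend on the finite generating set $S$, so one writes $\mathrm{Cl}_G$. Here $1$ denotes the constant function $1$ and $n$ the identity function. A finitely generated group is recursively presented if it has a presentation with finitely many generators and a recursively enumerable set of relators. *)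

(* Defs.v *)
From HB Require Import structures.
From mathcomp Require Import all_boot.
From mathcomp Require Import boolp classical_sets functions cardinality.

Set Implicit Arguments.
Unset Strict Implicit.
Unset Printing Implicit Defensive.

Local Open Scope classical_set_scope.

(* The default value 0 is never reached in the uses below: see
   [word_normP], [conj_distP] and [conj_lengthP]. *)
Definition nat_min (A : set nat) : nat :=
  xget 0 [set m | A m /\ forall k, A k -> m <= k].

Definition nat_max (A : set nat) : nat :=
  xget 0 [set m | A m /\ forall k, A k -> k <= m].

Lemma nat_minP (A : set nat) :
  A !=set0 -> A (nat_min A) /\ forall k, A k -> nat_min A <= k.
Proof.
move=> [a Aa]; apply: (@xgetPex _ 0 [set m | A m /\ forall k, A k -> m <= k]).
have exA : exists m, `[< A m >] by exists a; apply/asboolP.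
case: (ex_minnP exA) => m /asboolP Am mle.
by exists m; split=> // k Ak; apply: mle; apply/asboolP.
Qed.

Lemma nat_maxP (A : set nat) (b : nat) :
  A !=set0 -> (forall k, A k -> k <= b) ->
  A (nat_max A) /\ forall k, A k -> k <= nat_max A.
Proof.
move=> [a Aa] Ab; apply: (@xgetPex _ 0 [set m | A m /\ forall k, A k -> k <= m]).
have exA : exists m, `[< A m >] by exists a; apply/asboolP.
have ubA : forall m, `[< A m >] -> m <= b by move=> m /asboolP /Ab.
case: (ex_maxnP exA ubA) => m /asboolP Am mge.
by exists m; split=> // k Ak; apply: mge; apply/asboolP.
Qed.

Section ConjugatorLength.
Context {G : groupType}.
Implicit Types (S : set G) (g h : G) (w : seq G).
Local Open Scope group_scope.

Definition spells S w g : Prop :=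
  (forall x, x \in w -> S x \/ S x^-1) /\ \big[*%g/1]_(x <- w) x = g.

Definition generates S : Prop := forall g, exists w, spells S w g.

Definition word_norm S g : nat :=
  nat_min [set size w | w in [set w | spells S w g]].

Definition conjugates h g1 g2 : Prop := h * g1 * h^-1 = g2.

Definition conjugate g1 g2 : Prop := exists h, conjugates h g1 g2.

Definition conj_dist S g1 g2 : nat :=
  nat_min [set word_norm S h | h in [set h | conjugates h g1 g2]].

Definition conj_length S (n : nat) : nat :=
  nat_max [set conj_dist S p.1 p.2 | p in [set p : G * G |
    conjugate p.1 p.2 /\ (word_norm S p.1 + word_norm S p.2 <= n)%N]].

Lemma word_normP S g : generates S ->
  (exists2 w, spells S w g & size w = word_norm S g) /\
  forall w, spells S w g -> (word_norm S g <= size w)%N.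
Proof.
move=> genS; have [w Sw] := genS g.
have [|[v Sv sv] min] := @nat_minP [set size w | w in [set w | spells S w g]].
  by exists (size w), w.
by split; [exists v | move=> u Su; apply: min; exists u].
Qed.

Lemma conj_distP S g1 g2 : conjugate g1 g2 ->
  (exists2 h, conjugates h g1 g2 & word_norm S h = conj_dist S g1 g2) /\
  forall h, conjugates h g1 g2 -> (conj_dist S g1 g2 <= word_norm S h)%N.
Proof.
move=> [h Ch].
have [|[k Ck sk] min] := @nat_minP
    [set word_norm S h | h in [set h | conjugates h g1 g2]].
  by exists (word_norm S h), h.
by split; [exists k | move=> u Cu; apply: min; exists u].
Qed.

Lemma finite_ball S n : finite_set S -> generates S ->
  finite_set [set g | (word_norm S g <= n)%N].
Proof.
move=> finS genS; pose L : set G := S `|` [set x^-1 | x in S].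
have finL : finite_set L by rewrite finite_setU; split=> //; apply: finite_image.
have finB : finite_set [set g | exists2 w, spells S w g & (size w <= n)%N].
  elim: n => [|n IHn].
    apply: sub_finite_set (finite_set1 (1 : G)) => g [[|//] [_ <-] _] /=.
    by rewrite big_nil.
  have finU : finite_set ([set 1 : G] `|` [set p.1 * p.2 | p in
      L `*` [set g | exists2 w, spells S w g & (size w <= n)%N]]).
    rewrite finite_setU; split; first exact: finite_set1.
    by apply: finite_image; apply: finite_setX.
  apply: sub_finite_set finU => g [[|x w] [Sw <-] sw]; rewrite ?big_nil ?big_cons.
    by left.
  right; exists (x, \big[*%g/1]_(y <- w) y) => //=; split=> /=.
    case: (Sw x (mem_head _ _)) => [|Sx]; first by left.
    by right; exists x^-1 => //; rewrite invgK.
  by exists w => //; split=> // y wy; apply: Sw; rewrite in_cons wy orbT.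
apply: sub_finite_set finB => g /= gn.
by have [[w Sw sw] _] := word_normP g genS; exists w; rewrite ?sw.
Qed.

Lemma conj_lengthP S n : finite_set S -> generates S ->
  (exists g1 g2, [/\ conjugate g1 g2, (word_norm S g1 + word_norm S g2 <= n)%N
                   & conj_dist S g1 g2 = conj_length S n]) /\
  forall g1 g2, conjugate g1 g2 -> (word_norm S g1 + word_norm S g2 <= n)%N ->
    (conj_dist S g1 g2 <= conj_length S n)%N.
Proof.
move=> finS genS; pose P : set (G * G) := [set p |
  conjugate p.1 p.2 /\ (word_norm S p.1 + word_norm S p.2 <= n)%N].
have finP : finite_set P.
  apply: sub_finite_set (finite_setX (finite_ball n finS genS)
                                     (finite_ball n finS genS)).
  move=> [a b] [_ /= ab]; split=> /=; apply: leq_trans ab.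
    exact: leq_addr.
  exact: leq_addl.
have norm1 : word_norm S 1 = 0%N.
  apply/eqP; rewrite -leqn0; have [_ /(_ [::])] := word_normP 1 genS.
  by apply; split=> //; rewrite big_nil.
have P1 : P (1, 1).
  by split=> /=; [exists 1; rewrite /conjugates mulg1 mulgV | rewrite norm1].
have [b bP] : exists b, forall k, [set conj_dist S p.1 p.2 | p in P] k -> (k <= b)%N.
  have /finite_seqP[s sE] := finite_image (fun p => conj_dist S p.1 p.2) finP.
  exists (\max_(k <- s) k) => k; rewrite sE /= => ks.
  by rewrite (big_rem _ ks) leq_maxl.
have [|[[a c] [ac acn] aE] max] :=
    @nat_maxP [set conj_dist S p.1 p.2 | p in P] b _ bP.
  by exists (conj_dist S 1 1), (1, 1).
split; first by exists a, c.
by move=> g1 g2 g12 gn; apply: max; exists (g1, g2).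
Qed.

End ConjugatorLength.

Definition finitely_generated (G : groupType) : Prop :=
  exists2 S : set G, finite_set S & generates S.

Definition prec (g f : nat -> nat) : Prop :=
  exists C : nat, forall n : nat, g n <= C * f (C * n + C) + C.

Definition simeq (f g : nat -> nat) : Prop := prec f g /\ prec g f.

(* As conj_length is independent of the finite generating set up to simeq, the
   comparison with f is required for every finite generating set. *)
Definition conj_length_simeq (G : groupType) (f : nat -> nat) : Prop :=
  finitely_generated G /\
  forall S : set G, finite_set S -> generates S -> simeq (conj_length S) f.

Inductive rec_code : nat -> Type :=
| RZero : rec_code 0
| RSucc : rec_code 1
| RProj k (i : 'I_k) : rec_code k
| RComp k m (c : rec_code m) (d : 'I_m -> rec_code k) : rec_code k
| RPrim k (c : rec_code k) (d : rec_code k.+2) : rec_code k.+1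
| RMu k (c : rec_code k.+1) : rec_code k.

(* [rec_graph c x y]: the k-ary partial function with code c is defined at x
   and takes the value y there. In the RPrim case, s is the sequence of
   intermediate values s 0, ..., s (thead x). *)
Fixpoint rec_graph k (c : rec_code k) : k.-tuple nat -> nat -> Prop :=
  match c in rec_code k return k.-tuple nat -> nat -> Prop with
  | RZero => fun _ y => y = 0
  | RSucc => fun x y => y = (thead x).+1
  | RProj _ i => fun x y => y = tnth x i
  | RComp _ m c d => fun x y => exists z : m.-tuple nat,
      (forall i, rec_graph (d i) x (tnth z i)) /\ rec_graph c z y
  | RPrim _ c d => fun x y => exists s : nat -> nat,
      [/\ rec_graph c [tuple of behead x] (s 0),
          forall i, i < thead x ->
            rec_graph d [tuple of [:: i, s i & behead x]] (s i.+1)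
        & y = s (thead x)]
  | RMu _ c => fun x y => rec_graph c [tuple of y :: x] 0 /\
      forall i, i < y -> exists z, rec_graph c [tuple of i :: x] z.+1
  end.

Lemma rec_graph_fun k (c : rec_code k) x y z :
  rec_graph c x y -> rec_graph c x z -> y = z.
Proof.
elim: c x y z => /= {k}.
- by move=> x y z -> ->.
- by move=> x y z -> ->.
- by move=> k i x y z -> ->.
- move=> k m c IHc d IHd x y z [u [du cu]] [v [dv cv]].
  suff uv : u = v by rewrite -uv in cv; apply: IHc cu cv.
  by apply: eq_from_tnth => i; apply: IHd (du i) (dv i).
- move=> k c IHc d IHd x y z [s [s0 sS ->]] [t [t0 tS ->]].
  suff st i : i <= thead x -> s i = t i by apply: st.
  elim: i => [_|i IHi lti]; first exact: IHc s0 t0.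
  by have := tS i lti; rewrite -IHi 1?ltnW //; apply: IHd (sS i lti).
- move=> k c IHc x y z [cy ltcy] [cz ltcz].
  case: (ltngtP y z) => // [/ltcz|/ltcy] [v cv].
    by have := IHc _ _ _ cy cv.
  by have := IHc _ _ _ cz cv.
Qed.

Definition computable (f : nat -> nat) : Prop :=
  exists c : rec_code 1, forall n y, rec_graph c [tuple n] y <-> y = f n.

Definition rec_enumerable (A : set nat) : Prop :=
  exists c : rec_code 1, forall n, A n <-> exists y, rec_graph c [tuple n] y.

(* Words in the letters x_0, ..., x_(k-1) and their inverses; (i, true) stands
   for the inverse of x_i. *)
Definition word (k : nat) : Type := seq ('I_k * bool).

Definition word_inv k (w : word k) : word k := rev [seq (l.1, ~~ l.2) | l <- w].

Definition word_eval (G : groupType) k (x : 'I_k -> G) (w : word k) : G :=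
  (\big[*%g/1]_(l <- w) (if l.2 then (x l.1)^-1 else x l.1))%g.

(* Bijective Goedel numbering of lists of naturals, the letter (i, b) being
   numbered 2 * i + b. *)
Definition word_code k (w : word k) : nat :=
  CodeSeq.code [seq (nat_of_ord l.1).*2 + nat_of_bool l.2 | l <- w].

(* The words, not necessarily reduced, that represent an element of the normal
   closure of R in the free group on k letters. *)
Inductive normal_closure k (R : set (word k)) : word k -> Prop :=
| NCrel r : R r -> normal_closure R r
| NCone : normal_closure R [::]
| NCmul u v :
    normal_closure R u -> normal_closure R v -> normal_closure R (u ++ v)
| NCinv u : normal_closure R u -> normal_closure R (word_inv u)
| NCconj u v : normal_closure R u -> normal_closure R (v ++ u ++ word_inv v)
| NCinsert u v l : normal_closure R (u ++ v) ->
    normal_closure R (u ++ [:: l; (l.1, ~~ l.2)] ++ v)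
| NCdelete u v l : normal_closure R (u ++ [:: l; (l.1, ~~ l.2)] ++ v) ->
    normal_closure R (u ++ v).

(* The map from the free group on k letters to G given by x is onto, with
   kernel the normal closure of R. *)
Definition presents (G : groupType) k (R : set (word k)) (x : 'I_k -> G) :
    Prop :=
  (forall g, exists w, word_eval x w = g) /\
  (forall w, word_eval x w = 1%g <-> normal_closure R w).

Definition recursively_presented (G : groupType) : Prop :=
  exists (k : nat) (R : set (word k)) (x : 'I_k -> G),
    rec_enumerable [set word_code w | w in R] /\ presents R x.

(* Main.v *)
From HB Require Import structures.
From mathcomp Require Import all_boot.
From mathcomp Require Import boolp classical_sets functions cardinality fsbigop.
From mathcomp Require Import order ssralg ssrnum ssrint zify.
Require Import Defs.
Import Order.TTheory GRing.Theory Num.Theory.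

Set Implicit Arguments.
Unset Strict Implicit.
Unset Printing Implicit Defensive.

(* If some conjugacy class is infinite, then the elements met along a geodesic conjugator of a
   fixed element g have norm growing at most linearly, so the conjugator length is at least
   linear; otherwise the centre has finite index and conjugators can be taken among finitely
   many coset representatives.

   Conversely, let f dominate n and put F j = f (2^j) + 2^j. The group is an extension of
   the lamplighter group (Z/2)^2 wr Z, generated by t and the lamps a, b, by a central elementary
   abelian 2-group with basis c_0, c_1, ...; writing x_i = t^i x t^-i, the only non-trivial
   commutators of lamps are [a_i, a_(i + F j)] = [b_i, b_(i + 2^j)] = c_j. The norm of an element
   is, up to a constant factor, the least n such that its position and lamps lie in [-n, n] and its
   central coordinates j satisfy 2^j <= 2n. In particular c_j has norm O(2^j), while a conjugator
   from a to c_j a has to carry an a-lamp at F j or -F j. The indices F j and 2^j are so sparse that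
   lamps of a conjugator that are further away than F (log n) + O(n) may be switched off, which
   gives the matching upper bound. The word problem of this group is decided by finite sums
   that only involve f, so for computable f all trivial words form an enumerable set of relators. *)

Local Open Scope classical_set_scope.

(** * Word norms and the dichotomy *)

Lemma prec_trans g f h : {homo h : m n / m <= n} -> prec f g -> prec g h -> prec f h.
Proof.
move=> hm [C fg] [D gh]; exists (C * D + C + D) => n.
apply: leq_trans (fg n) _; set E := C * D + C + D.
have leE : D * (C * n + C) + D <= E * n + E by rewrite /E; nia.
have := gh (C * n + C); have := hm _ _ leE; move: (h _) (h _) (g _) => x y z xy zx.
by rewrite /E in leE *; nia.
Qed.

Section WordNorm.
Variable G : groupType.
Implicit Types (S T : set G) (g h : G).
Local Open Scope group_scope.

(** A norm bound given by a witness word, meaningful before [S] is known to generate: [lg_generates]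
    is itself derived from such bounds. *)
Definition short S (n : nat) g := exists2 w, spells S w g & (size w <= n)%N.

Lemma short1 S : short S 0 1.
Proof. by exists [::]; rewrite ?big_nil //; split; rewrite ?big_nil. Qed.

Lemma short_gen S g : S g -> short S 1 g.
Proof.
move=> Sg; exists [:: g] => //; split; last by rewrite big_seq1.
by move=> x; rewrite inE => /eqP ->; left.
Qed.

Lemma short_mul S m n g h : short S m g -> short S n h -> short S (m + n) (g * h).
Proof.
move=> [u [Su <-] um] [v [Sv <-] vn]; exists (u ++ v).
  split; last by rewrite big_cat.
  by move=> x; rewrite mem_cat => /orP [/Su|/Sv].
by rewrite size_cat leq_add.
Qed.

Lemma short_inv S n g : short S n g -> short S n g^-1.
Proof.
move=> [w [Sw <-] wn]; exists (rev [seq x^-1 | x <- w]); last by rewrite size_rev size_map.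
split=> [x|].
  rewrite mem_rev => /mapP[y /Sw yS ->]; rewrite invgK; tauto.
elim: w {Sw wn} => [|x w IHw]; first by rewrite !big_nil invg1.
by rewrite /= rev_cons -cats1 big_cat big_seq1 IHw big_cons invgM.
Qed.

Lemma short_le S m n g : (m <= n)%N -> short S m g -> short S n g.
Proof. by move=> mn [w Sw wm]; exists w => //; apply: leq_trans mn. Qed.

Lemma shortX S n g k : short S n g -> short S (k * n) (g ^+ k).
Proof.
move=> sg; elim: k => [|k IHk]; first by rewrite expg0 mul0n; apply: short1.
by rewrite expgS mulSn; apply: short_mul.
Qed.

Section Generating.
Variables (S : set G) (genS : generates S).

Lemma word_norm_le g n : (word_norm S g <= n)%N <-> short S n g.
Proof.
have [[w Sw wg] min] := word_normP g genS; split=> [gn|[v /min gv vn]].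
  by exists w => //; rewrite wg.
exact: leq_trans vn.
Qed.

Lemma word_norm_spec g : short S (word_norm S g) g.
Proof. exact/word_norm_le. Qed.

Lemma word_normM g h : (word_norm S (g * h) <= word_norm S g + word_norm S h)%N.
Proof. by apply/word_norm_le/short_mul; apply: word_norm_spec. Qed.

Lemma word_normV g : (word_norm S g^-1 <= word_norm S g)%N.
Proof. by apply/word_norm_le/short_inv/word_norm_spec. Qed.

End Generating.

(** [K] is the largest [T]-norm of an element of [S]; rewrite an [S]-geodesic letter by letter. *)
Lemma word_norm_lipschitz S T : finite_set S -> generates S -> generates T ->
  exists K, forall g, (word_norm T g <= K * word_norm S g)%N.
Proof.
move=> /finite_seqP[s ->] genS genT.
exists (\max_(x <- s) word_norm T x)%N => g; set K := (X in (X * _)%N).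
have KP x : [set` s] x -> (word_norm T x <= K)%N.
  by move=> xs; apply: (@leq_bigmax_seq _ s xpredT (word_norm T)).
have [w [Sw <-] sw] := word_norm_spec genS g.
apply: leq_trans (leq_mul (leqnn K) sw); elim: w Sw {sw} => [|x w IHw] Sw.
  by rewrite big_nil muln0; apply/(word_norm_le genT)/short1.
rewrite big_cons /= mulnS; apply: leq_trans (word_normM genT _ _) _; apply: leq_add.
  case: (Sw x (mem_head _ _)) => [/KP //|/KP]; apply: leq_trans.
  by rewrite -{1}(invgK x); apply: word_normV.
by apply: IHw => y yw; apply: Sw; rewrite in_cons yw orbT.
Qed.

Lemma conj_length_mono S m n : finite_set S -> generates S -> (m <= n)%N ->
  (conj_length S m <= conj_length S n)%N.
Proof.
move=> finS genS mn; have [[g [h [gh ghm <-]]] _] := conj_lengthP m finS genS.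
by have [_] := conj_lengthP n finS genS; apply=> //; apply: leq_trans mn.
Qed.

Lemma conj_length_prec S T : finite_set S -> generates S -> finite_set T ->
  generates T -> prec (conj_length S) (conj_length T).
Proof.
move=> finS genS finT genT.
have [K KP] := word_norm_lipschitz finS genS genT.
have [M MP] := word_norm_lipschitz finT genT genS.
exists (K + M)%N => n; have [[g [h [gh ghn <-]]] _] := conj_lengthP n finS genS.
have [[x xgh xT] _] := conj_distP T gh; have [_ min] := conj_distP S gh.
have := min _ xgh; have := MP x; rewrite xT.
have := KP g; have := KP h => Kh Kg.
have [_ /(_ _ _ gh)] := conj_lengthP ((K + M) * n + (K + M)) finT genT.
move: (conj_length _ _) (conj_dist _ _ _) => p q; nia.
Qed.

Lemma conj_length_simeq_gen S f : {homo f : m n / (m <= n)%N} ->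
  finite_set S -> generates S -> simeq (conj_length S) f -> conj_length_simeq G f.
Proof.
move=> fm finS genS [Sf fS]; split; first by exists S.
move=> T finT genT; split.
  by apply: prec_trans fm _ Sf; apply: conj_length_prec.
apply: (@prec_trans (conj_length S)) => //; last exact: conj_length_prec.
by move=> m n; apply: conj_length_mono.
Qed.

Lemma conjugatesM x y g1 g2 g3 : conjugates x g1 g2 -> conjugates y g2 g3 ->
  conjugates (y * x) g1 g3.
Proof. by rewrite /conjugates => <- <-; rewrite invgM !mulgA. Qed.

(** Balls are finite, so some conjugate [g2] of [g] is at conjugator distance more than [i]. Cut a
    shortest conjugator as [x = y * z] with [z] of length [i]. Then [g1 = z * g * z^-1] has norm at
    most [|g| + 2i], and its distance from [g] is at least [i]: a shorter conjugator [t] would make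
    [y * t] beat [x]. *)
Lemma conj_length_linear S g : finite_set S -> generates S ->
  infinite_set [set h * g * h^-1 | h in [set: G]] ->
  prec (fun n => n) (conj_length S).
Proof.
(* The constant covers the total norm of the pair [g], [g1], which is at most [2|g| + 2i]. *)
move=> finS genS infg; exists (2 * word_norm S g + 2)%N => i.
have [h ih] : exists h, (i < conj_dist S g (h * g * h^-1))%N.
  apply: contrapT => noh; apply: infg.
  apply: sub_finite_set (finite_image (fun x => x * g * x^-1) (finite_ball i finS genS)).
  move=> _ [h _ <-].
  have [[x xh xd] _] := @conj_distP _ S g (h * g * h^-1) (ex_intro _ h erefl).
  exists x => //=; rewrite xd leqNgt; apply/negP => ih; apply: noh; by exists h.
set g2 := h * g * h^-1 in ih.
have gg2 : conjugate g g2 by exists h.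
have [[x xg2 xd] min] := conj_distP S gg2.
have [w [Sw wx] sw] := word_norm_spec genS x; rewrite xd in sw.
have [lt_iw | le_wi] := ltnP i (size w); last first.
  have := word_norm_le genS x (size w) => -[_]; rewrite xd.
  by move=> /(_ (ex_intro2 _ _ w (conj Sw wx) (leqnn _))); move: ih; lia.
pose u := take (size w - i) w; pose v := drop (size w - i) w.
have uv : w = u ++ v by rewrite cat_take_drop.
pose y := \big[*%g/1]_(z <- u) z; pose z := \big[*%g/1]_(z <- v) z.
have xyz : x = y * z by rewrite -wx uv big_cat.
have sy : short S (size w - i) y.
  exists u; last by rewrite size_take; case: ifP => //; lia.
  by split=> // t tu; apply: Sw; rewrite uv mem_cat tu.
have sz : short S i z.
  exists v; last by rewrite size_drop; lia.
  by split=> // t tv; apply: Sw; rewrite uv mem_cat tv orbT.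
pose g1 := z * g * z^-1.
have gg1 : conjugate g g1 by exists z.
have g1g2 : conjugates y g1 g2.
  by rewrite /conjugates -xg2 /g1 xyz invgM !mulgA.
have [[t tg1 td] _] := conj_distP S gg1.
have lei : (i <= conj_dist S g g1)%N.
  rewrite leqNgt; apply/negP => lti.
  have := min _ (conjugatesM tg1 g1g2).
  have := word_normM genS y t; have /word_norm_le := sy => /(_ genS).
  rewrite td; have := word_norm_le genS x (size w) => -[_]; rewrite xd.
  move=> /(_ (ex_intro2 _ _ w (conj Sw wx) (leqnn _))).
  by move: lti lt_iw; lia.
have ng1 : (word_norm S g1 <= word_norm S g + 2 * i)%N.
  apply/(word_norm_le genS).
  apply: (@short_le _ (i + word_norm S g + i)); first by lia.
  apply: short_mul (short_inv sz).
  by apply: short_mul => //; apply: word_norm_spec.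
have [_ /(_ _ _ gg1)] := conj_lengthP ((2 * word_norm S g + 2) * i + (2 * word_norm S g + 2)) finS genS.
move=> /(_ ltac:(nia)); move: lei; nia.
Qed.

(** [phi h] lists the conjugates of the generators by [h]. It takes finitely many values, and two
    elements with the same value differ by a central factor, so they conjugate alike. One
    representative per value therefore suffices, and the bound is the largest norm of these. *)
Lemma conj_length_bounded S : finite_set S -> generates S ->
  (forall g, finite_set [set h * g * h^-1 | h in [set: G]]) ->
  exists B, forall n, (conj_length S n <= B)%N.
Proof.
move=> finS genS fcG; have /finite_seqP[s sE] := finS.
pose phi h := [seq h * g * h^-1 | g <- s].
have fin_phi : finite_set (range phi).
  rewrite /phi; elim: s {sE phi} => [|g s IHs].
    apply: sub_finite_set (finite_set1 [::]) => _ [h _ <-] //=.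
  apply: sub_finite_set (finite_image (fun p => p.1 :: p.2) (finite_setX (fcG g) IHs)).
  by move=> _ [h _ <-]; exists (h * g * h^-1, [seq h * g * h^-1 | g <- s]) => //; split=> /=; exists h.
pose rep (y : seq G) := xget 1 [set h | phi h = y].
have phi_rep h : phi (rep (phi h)) = phi h.
  by rewrite /rep; case: xgetP => [x _ //|/(_ h)]; case.
have /finite_seqP[ys ysE] := fin_phi.
exists (\max_(y <- ys) word_norm S (rep y))%N => n.
have [[g1 [g2 [[h hg] _ <-]]] _] := conj_lengthP n finS genS.
have [z zE] : exists z, z = (rep (phi h))^-1 * h by exists ((rep (phi h))^-1 * h).
have zs x : x \in s -> z * x = x * z.
  move=> xs; have := phi_rep h => /eq_in_map /(_ x xs) /= E.
  rewrite zE -!mulgA; apply: (mulgI (rep (phi h))).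
  by apply: (mulIg h^-1); rewrite !mulgA mulgV mul1g E mulgK.
have zS x : S x -> z * x = x * z by rewrite sE; apply: zs.
have zC g : z * g = g * z.
  have [w [Sw <-]] := genS g; elim: w Sw => [|x w IHw] Sw.
    by rewrite big_nil mulg1 mul1g.
  rewrite big_cons mulgA.
  have -> : z * x = x * z.
    case: (Sw x (mem_head _ _)) => [/zS //|/zS zx].
    by apply: (mulgI x^-1); rewrite mulgA -zx -mulgA mulVg mulg1 mulKg.
  rewrite -mulgA IHw ?mulgA // => y yw; apply: Sw; by rewrite in_cons yw orbT.
have rg : conjugates (rep (phi h)) g1 g2.
  have -> : rep (phi h) = h * z^-1 by rewrite zE invgM invgK mulgA mulgV mul1g.
  rewrite /conjugates -hg (invgM h) invgK -!mulgA; congr (_ * _).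
  by rewrite [g1 * (z * _)]mulgA -zC -mulgA mulKg.
have [_ /(_ _ rg)] := conj_distP S (ex_intro _ h hg); move=> /leq_trans; apply.
apply: (@leq_bigmax_seq _ ys xpredT (fun y => word_norm S (rep y))) => //.
have : [set` ys] (phi h) by rewrite -ysE; exists h.
by [].
Qed.

Lemma conj_length_dichotomy f : {homo f : m n / (m <= n)%N} ->
  conj_length_simeq G f -> simeq f (fun _ => 1%N) \/ prec (fun n => n) f.
Proof.
move=> fm [[S finS genS] /(_ S finS genS)[Sf fS]].
have [fcG|] := pselect (forall g : G, finite_set [set h * g * h^-1 | h in [set: G]]).
  left; have [B BP] := conj_length_bounded finS genS fcG; have [C CP] := fS.
  split; last by exists 1%N => n; lia.
  exists (C * B + C)%N => n; have := CP n; have := BP (C * n + C)%N; nia.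
move=> /existsNP[g infg]; right; apply: prec_trans fm _ Sf.
exact: conj_length_linear infg.
Qed.

End WordNorm.

(** * The group *)

Section FiniteParity.
Local Open Scope ring_scope.
Implicit Types (u v : bool * int -> bool).

Definition bounded n u := forall p, u p -> (`|p.2| <= n)%N.

(** The value is the default [false] when the support of [u] is infinite; additivity is therefore
    stated under [bounded]. *)
Definition parity u : bool := \big[addb/false]_(p \in [set: bool * int]) u p.

Lemma finite_bounded n : finite_set [set p : bool * int | (`|p.2| <= n)%N].
Proof.
pose g (q : bool * bool * nat) : bool * int := (q.1.1, if q.1.2 then q.2%:Z else - q.2%:Z).
have finI : finite_set ([set: bool * bool] `*` `I_n.+1).
  by apply: finite_setX; [exact: finite_finset | exact: finite_II].
apply: sub_finite_set (finite_image g finI) => -[s i] /= ni.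
exists (s, 0 <= i, `|i|%N); first by split => //=; rewrite ltnS.
by rewrite /g /=; congr (_, _); case: ifP; lia.
Qed.

Lemma parityE n u : bounded n u ->
  parity u = \big[addb/false]_(p \in [set p : bool * int | (`|p.2| <= n)%N]) u p.
Proof.
move=> nu; apply/esym/fsbig_widen => // p [_ /= np].
by apply: contra_notF np => /nu.
Qed.

Lemma parityD n u v : bounded n u -> bounded n v ->
  parity (fun p => u p (+) v p) = parity u (+) parity v.
Proof.
move=> nu nv; rewrite (parityE nu) (parityE nv) (@parityE n).
  by rewrite fsbig_split //; apply: finite_bounded.
by move=> p; case: (boolP (u p)) => [/nu|_ /nv].
Qed.

Lemma parity0 u : (forall p, u p = false) -> parity u = false.
Proof. by move=> u0; apply: fsbig1. Qed.

Lemma parity_ex u : parity u -> exists p, u p.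
Proof.
move=> pu; apply: contrapT => /forallNP nu; move: pu.
by rewrite parity0 // => p; apply/negP/nu.
Qed.

Lemma eq_parity u v : u =1 v -> parity u = parity v.
Proof. by move/funext => ->. Qed.

Lemma parity_reindex u (h : bool * int -> bool * int) : bijective h ->
  parity u = parity (u \o h).
Proof. by move=> bh; rewrite /parity (@reindex_fsbigT _ false addb _ _ h u bh). Qed.

Lemma parity1 u p : (forall q, u q -> q = p) -> parity u = u p.
Proof.
move=> up; rewrite -[RHS](@fsbig_set1 _ _ addb _ p u); apply/esym/fsbig_widen => // q [_ /=].
by apply: contra_notF => /up.
Qed.

End FiniteParity.

(** * The central extension of the lamplighter group *)

Section Construction.
Variable f : nat -> nat.
Local Open Scope ring_scope.
Implicit Types (u v w : bool * int -> bool) (k : int).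

(** The distance at which two lamps of type [s] have commutator [c_n]: [F n] for the a-lamps
    ([true]), [2 ^ n] for the b-lamps ([false]). *)
Definition gap (s : bool) (n : nat) : nat := if s then (f (2 ^ n) + 2 ^ n)%N else (2 ^ n)%N.

Lemma gap_ge s n : (2 ^ n <= gap s n)%N.
Proof. by case: s; rewrite /= ?leq_addl. Qed.

Definition shift k u : bool * int -> bool := fun p => u (p.1, p.2 - k).

Definition addl u v : bool * int -> bool := fun p => u p (+) v p.

(** The cocycle of the central extension. It looks only to the right, so [form u v] and [form v u]
    differ by the commutator of [u] and [v]. *)
Definition form u v (n : nat) : bool :=
  parity (fun p => u p && v (p.1, p.2 + (gap p.1 n)%:Z)).

Lemma bounded_le m n u : (m <= n)%N -> bounded m u -> bounded n u.
Proof. by move=> mn mu p /mu pm; apply: leq_trans mn. Qed.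

Lemma bounded_shift n u k : bounded n u -> bounded (n + `|k|%N) (shift k u).
Proof. by move=> nu p /nu /=; lia. Qed.

Lemma bounded_addl n u v : bounded n u -> bounded n v -> bounded n (addl u v).
Proof. by move=> nu nv p; rewrite /addl; case: (boolP (u p)) => [/nu|_ /nv]. Qed.

Lemma form_addl n u v w : bounded n u -> bounded n v ->
  form (addl u v) w = (fun j => form u w j (+) form v w j).
Proof.
move=> nu nv; apply: funext => j; rewrite /form -(@parityD n).
- by apply: eq_parity => p; rewrite /addl andb_addl.
- by move=> p /andP[/nu].
- by move=> p /andP[/nv].
Qed.

Lemma form_addr n u v w : bounded n u ->
  form u (addl v w) = (fun j => form u v j (+) form u w j).
Proof.
move=> nu; apply: funext => j; rewrite /form -(@parityD n).
- by apply: eq_parity => p; rewrite /addl andb_addr.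
- by move=> p /andP[/nu].
- by move=> p /andP[/nu].
Qed.

Lemma form_shift k u v : form (shift k u) (shift k v) = form u v.
Proof.
apply: funext => j; rewrite /form (@parity_reindex _ (fun p => (p.1, p.2 + k))).
  by apply: eq_parity => -[s i]; rewrite /shift /=; congr (u (_, _) && v (_, _)); lia.
by exists (fun p => (p.1, p.2 - k)) => -[s i] /=; rewrite ?addrK ?subrK.
Qed.

Lemma form_ex u v j : form u v j ->
  exists s i, u (s, i) /\ v (s, i + (gap s j)%:Z).
Proof. by move=> /parity_ex[[s i] /andP[ui vi]]; exists s, i. Qed.

Lemma form0l v : form (fun _ => false) v = fun _ => false.
Proof. by apply: funext => j; apply: parity0. Qed.

Lemma form0r u : form u (fun _ => false) = fun _ => false.
Proof. by apply: funext => j; apply: parity0 => p; rewrite andbF. Qed.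

Definition raw := (int * (bool * int -> bool) * (nat -> bool))%type.

(* Position, lamps and central part: the lamp (true, i) is the generator
   a_i = t^i a t^-i of the base, the lamp (false, i) is b_i = t^i b t^-i. *)
Definition box n (x : raw) : Prop :=
  [/\ (`|x.1.1| <= n)%N, bounded n x.1.2 & forall j, x.2 j -> (2 ^ j <= 2 * n)%N].

Definition raw_mul (x y : raw) : raw :=
  (x.1.1 + y.1.1, addl x.1.2 (shift x.1.1 y.1.2),
   fun j => x.2 j (+) y.2 j (+) form x.1.2 (shift x.1.1 y.1.2) j).

Definition raw_one : raw := (0, fun _ => false, fun _ => false).

Definition raw_inv (x : raw) : raw :=
  (- x.1.1, shift (- x.1.1) x.1.2, fun j => x.2 j (+) form x.1.2 x.1.2 j).

Lemma box_le m n x : (m <= n)%N -> box m x -> box n x.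
Proof.
move=> mn [xm um cm]; split; [exact: leq_trans mn | exact: bounded_le um |].
by move=> j /cm; lia.
Qed.

(** A central coordinate [j] that is new in the product comes from lamps in [[-m, m]] and
    [[-(m + n), m + n]] at distance at least [2 ^ j]; this is why [box] has the factor 2. *)
Lemma box_mul m n x y : box m x -> box n y -> box (m + n) (raw_mul x y).
Proof.
move=> [xm um cm] [yn vn dn]; split => /=; first lia.
  apply: bounded_addl; first by apply: bounded_le um; lia.
  apply: (bounded_le _ (bounded_shift vn)); lia.
move=> j; case: (boolP (x.2 j)) => [/cm|_]; first lia.
case: (boolP (y.2 j)) => [/dn|_ /=]; first lia.
move=> /form_ex[s [i [/um ui /vn]]]; have := gap_ge s j; move: ui => /=; lia.
Qed.

Lemma box_inv n x : box n x -> exists m, box m (raw_inv x).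
Proof.
move=> [xn un cn]; exists (2 * n)%N; split => /=; first lia.
  by apply: (bounded_le _ (bounded_shift un)); lia.
move=> j; case: (boolP (x.2 j)) => [/cn|_ /=]; first lia.
move=> /form_ex[s [i [/un ui /un]]]; have := gap_ge s j; move: ui => /=; lia.
Qed.

Lemma box_one n : box n raw_one. Proof. by split. Qed.

Definition boxed (x : raw) : bool := `[< exists n, box n x >].

(* The group law depends on f, so the type must mention f for the group
   structure to be inferred. *)
Definition lampgroup := (fun _ : nat -> nat => {x : raw | boxed x}) f.

HB.instance Definition _ := gen_eqMixin lampgroup.
HB.instance Definition _ := gen_choiceMixin lampgroup.

Implicit Types x y z : lampgroup.

Lemma ex_box x : exists n, box n (val x). Proof. exact/asboolP/(valP x). Qed.

Lemma mul_subproof x y : boxed (raw_mul (val x) (val y)).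
Proof.
apply/asboolP; have [[m xm] [n yn]] := (ex_box x, ex_box y).
by exists (m + n)%N; apply: box_mul.
Qed.

Lemma inv_subproof x : boxed (raw_inv (val x)).
Proof. by apply/asboolP; have [n /box_inv] := ex_box x. Qed.

Lemma one_subproof : boxed raw_one.
Proof. by apply/asboolP; exists 0%N; apply: box_one. Qed.

Definition lg_mul x y : lampgroup := exist boxed _ (mul_subproof x y).
Definition lg_inv x : lampgroup := exist boxed _ (inv_subproof x).
Definition lg_one : lampgroup := exist boxed _ one_subproof.

Lemma shift0 u : shift 0 u = u.
Proof. by apply: funext => -[s i]; rewrite /shift /= subr0. Qed.

Lemma shiftD k l u : shift (k + l) u = shift k (shift l u).
Proof. by apply: funext => -[s i]; rewrite /shift /= opprD addrA. Qed.

Lemma shift_addl k u v : shift k (addl u v) = addl (shift k u) (shift k v).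
Proof. by []. Qed.

Lemma addlA : associative addl.
Proof. by move=> u v w; apply: funext => p; rewrite /addl addbA. Qed.

Lemma addlC : commutative addl.
Proof. by move=> u v; apply: funext => p; rewrite /addl addbC. Qed.

Lemma addlK u v : addl u (addl u v) = v.
Proof. by apply: funext => p; rewrite /addl addKb. Qed.

Lemma addl0 u : addl u (fun _ => false) = u.
Proof. by apply: funext => p; rewrite /addl addbF. Qed.

Lemma add0l u : addl (fun _ => false) u = u.
Proof. by rewrite addlC addl0. Qed.

Lemma addll u : addl u u = fun _ => false.
Proof. by apply: funext => p; rewrite /addl addbb. Qed.

(** The cocycle identity follows from biadditivity and shift invariance of [form]. *)
Lemma raw_mulA m n (x y z : raw) : bounded n x.1.2 -> bounded m y.1.2 ->
  raw_mul x (raw_mul y z) = raw_mul (raw_mul x y) z.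
Proof.
move: x y z => [[k u] c] [[l v] d] [[m' w] e] /= nu mv; rewrite /raw_mul /=.
rewrite shift_addl addrA shiftD addlA; congr (_, _, _); apply: funext => j.
rewrite (form_addr _ _ nu) (@form_addl (n + m + `|k|)%N); first last.
- by apply: (bounded_le _ (bounded_shift mv)); lia.
- by apply: bounded_le nu; lia.
rewrite form_shift.
by case: (c j); case: (d j); case: (e j); do 3! case: (form _ _ _).
Qed.

Lemma lg_mulA : associative lg_mul.
Proof.
move=> x y z; apply: val_inj.
have [[n [_ xn _]] [m [_ ym _]]] := (ex_box x, ex_box y).
exact: raw_mulA xn ym.
Qed.

Lemma lg_mul1 : left_id lg_one lg_mul.
Proof.
move=> [[[k u] c] ?]; apply: val_inj; rewrite /= /raw_mul /= add0r shift0 add0l form0l.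
by congr (_, _, _); apply: funext => j; rewrite addbF.
Qed.

Lemma lg_1mul : right_id lg_one lg_mul.
Proof.
move=> [[[k u] c] ?]; apply: val_inj; rewrite /= /raw_mul /= addr0 addl0 form0r.
by congr (_, _, _); apply: funext => j; rewrite !addbF.
Qed.

Lemma lg_mulV : right_inverse lg_one lg_inv lg_mul.
Proof.
move=> [[[k u] c] ?]; apply: val_inj; rewrite /= /raw_mul /raw_inv /raw_one /=.
rewrite -shiftD subrr shift0 addll.
by congr (_, _, _); apply: funext => j; case: (c j); case: (form _ _ _).
Qed.

Lemma lg_Vmul : left_inverse lg_one lg_inv lg_mul.
Proof.
move=> [[[k u] c] ?]; apply: val_inj; rewrite /= /raw_mul /raw_inv /raw_one /=.
rewrite addll form_shift addrC subrr.
by congr (_, _, _); apply: funext => j; case: (c j); case: (form _ _ _).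
Qed.

HB.instance Definition _ := isGroup.Build lampgroup lg_mulA lg_mul1 lg_1mul lg_Vmul lg_mulV.

End Construction.

(** * The word norm of the group *)

Section WordMetric.
Variable f : nat -> nat.
Local Open Scope ring_scope.
Local Notation G := (lampgroup f).
Implicit Types (u v w : bool * int -> bool) (c : nat -> bool) (k : int) (x y g h : G).

Definition pos g : int := (val g).1.1.
Definition lamps g : bool * int -> bool := (val g).1.2.
Definition cen g : nat -> bool := (val g).2.

Lemma lg_ext g h : pos g = pos h -> lamps g = lamps h -> cen g = cen h -> g = h.
Proof.
rewrite /pos /lamps /cen => gh1 gh2 gh3; apply: val_inj.
by move: (val g) (val h) gh1 gh2 gh3 => [[? ?] ?] [[? ?] ?] /= -> -> ->.
Qed.

Lemma posM g h : pos (g * h)%g = pos g + pos h. Proof. by []. Qed.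

Lemma lampsM g h : lamps (g * h)%g = addl (lamps g) (shift (pos g) (lamps h)).
Proof. by []. Qed.

Lemma cenM g h : cen (g * h)%g =
  fun j => cen g j (+) cen h j (+) form f (lamps g) (shift (pos g) (lamps h)) j.
Proof. by []. Qed.

Definition mk_raw n (r : raw) (rn : box n r) : G :=
  exist boxed r (introT (asboolP _) (ex_intro _ n rn)).

Definition nolamp : bool * int -> bool := fun _ => false.

Definition unit_lamp (s : bool) (i : int) : bool * int -> bool := pred1 (s, i).

Lemma box_shift1 : box 1 (1 : int, nolamp, fun=> false). Proof. by split. Qed.

Lemma box_lamp s : box 1 (0 : int, unit_lamp s 0, fun=> false).
Proof. by split => // p /eqP ->. Qed.

Definition lg_t : G := mk_raw box_shift1.

Definition lg_lamp s : G := mk_raw (box_lamp s).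

Lemma shift_nolamp k : shift k nolamp = nolamp. Proof. by []. Qed.

Lemma shift_unit k s i : shift k (unit_lamp s i) = unit_lamp s (i + k).
Proof.
apply: funext => -[s' j]; rewrite /shift /unit_lamp /= !xpair_eqE; congr (_ && _); lia.
Qed.

(** Gaps are positive, so a lamp does not interact with itself. *)
Lemma lg_lampV s : ((lg_lamp s)^-1 = lg_lamp s)%g.
Proof.
apply/esym/eqP; rewrite -mulg_eq1; apply/eqP; apply: lg_ext => //.
  by rewrite lampsM shift0 addll.
rewrite cenM shift0; apply: funext => j /=; apply: negbTE; apply/negP => /form_ex.
move=> [s' [i [/eqP[_ ->] /eqP[_]]]]; have := gap_ge f s' j; lia.
Qed.

(** The order a, b, t fixes the letter numbers that [word_code] assigns and the word problem
    reads. *)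
Definition lg_gen (i : 'I_3) : G :=
  if i == 0%N :> nat then lg_lamp true else if i == 1%N :> nat then lg_lamp false else lg_t.

Definition lg_gens : set G := range lg_gen.

Lemma lg_gens_finite : finite_set lg_gens.
Proof. by apply: finite_image; apply: finite_finset. Qed.

Lemma lg_gens_t : lg_gens lg_t.
Proof. by exists (inord 2) => //; rewrite /lg_gen inordK. Qed.

Lemma lg_gens_lamp s : lg_gens (lg_lamp s).
Proof. by exists (inord (~~ s)) => //; rewrite /lg_gen inordK //; case: s. Qed.

Lemma lg_gen_box i : box 1 (val (lg_gen i)).
Proof. by rewrite /lg_gen; case: ifP => _; last case: ifP => _; do ?[exact: box_lamp | exact: box_shift1]. Qed.

Lemma lg_gen_inv_box i : box 1 (val (lg_gen i)^-1%g).
Proof.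
rewrite /lg_gen; do 2 (case: ifP => _; first by rewrite lg_lampV; apply: box_lamp).
by split => //= j; rewrite form0l.
Qed.

(** The lower bound for the norm: generators and their inverses lie in [box 1], and boxes
    multiply. *)
Lemma short_box n g : short lg_gens n g -> box n (val g).
Proof.
move=> [w [Sw <-] wn]; apply: box_le wn _; elim: w Sw => [|x w IHw] Sw.
  by rewrite big_nil; apply: box_one.
rewrite big_cons; apply: (@box_mul _ 1).
  case: (Sw x (mem_head _ _)) => -[i _ gi]; first by rewrite -gi; apply: lg_gen_box.
  by rewrite -[x]invgK -gi; apply: lg_gen_inv_box.
by apply: IHw => y yw; apply: Sw; rewrite in_cons yw orbT.
Qed.

Lemma tpow_short k : exists g,
  [/\ short lg_gens `|k|%N g, pos g = k & lamps g = nolamp].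
Proof.
pose s := if 0 <= k then lg_t else lg_t^-1%g.
have sS : short lg_gens 1 s.
  by rewrite /s; case: ifP => _; [|apply: short_inv]; apply: short_gen lg_gens_t.
exists (s ^+ `|k|)%g; split; first by have := shortX `|k|%N sS; rewrite muln1.
  have -> n : pos (s ^+ n)%g = if 0 <= k then n%:Z else - n%:Z.
    elim: n => [|n IHn]; first by case: ifP.
    rewrite expgS posM {}IHn /s; case: ifP => _.
      by rewrite -[pos lg_t]/(1 : int); lia.
    by rewrite -[pos lg_t^-1%g]/(-1 : int); lia.
  by case: ifP; lia.
elim: `|k|%N => [//|n IHn]; rewrite expgS lampsM IHn shift_nolamp addl0 /s.
by case: ifP.
Qed.

(** Walk from 0 to [m], setting both lamps at each site: at most three letters per site. *)
Lemma sweep_short u m : exists g, [/\ short lg_gens (3 * m) g, pos g = m%:Z &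
  lamps g = fun p => (0 <= p.2 < m%:Z) && u p].
Proof.
elim: m => [|m [g [sg pg lg]]].
  exists 1%g; split => //; first by rewrite muln0; apply: short1.
  by apply: funext => p; have -> : (0 <= p.2 < 0%:Z) = false by lia.
pose z s := if u (s, m%:Z) then lg_lamp s else 1%g.
have zS s : short lg_gens 1 (z s).
  rewrite /z; case: ifP => _; first exact: short_gen (lg_gens_lamp s).
  by apply: short_le (short1 _).
have zp s : pos (z s) = 0 by rewrite /z; case: ifP.
exists (g * z true * z false * lg_t)%g; split.
- rewrite mulnS addnC -(addn1 2) -(addn1 1) !addnA.
  by do ![apply: short_mul] => //; apply: short_gen lg_gens_t.
- by rewrite !posM !zp pg -[pos lg_t]/(1 : int); lia.
rewrite !lampsM !posM !zp !addr0 pg lg shift_nolamp addl0.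
have zl s : shift m%:Z (lamps (z s)) = fun p => (p == (s, m%:Z)) && u p.
  apply: funext => p; rewrite /z; case: ifP => us.
    rewrite -[lamps _]/(unit_lamp s 0) shift_unit add0r; case: (p =P _) => [->|/eqP/negbTE //].
    by rewrite us /unit_lamp /= eqxx.
  by case: (p =P _) => [->|//]; rewrite us.
rewrite !zl; apply: funext => -[s i]; rewrite /addl !xpair_eqE /=.
have [->|im] := eqVneq i m%:Z.
  by rewrite ltxx andbF /= ltz_nat ltnS leqnn; case: s => /=; rewrite ?addbF.
by rewrite !andbF !addbF; congr (_ && _); lia.
Qed.

(** Go to [-n], sweep [2n + 1] sites and return: [n + 3(2n + 1) + (n + 1) = 8n + 4] letters. The
    central part is left uncontrolled; [box_short] corrects it. *)
Lemma lamps_short n u : bounded n u ->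
  exists g, [/\ short lg_gens (8 * n + 4) g, pos g = 0 & lamps g = u].
Proof.
move=> nu; have [x [sx px lx]] := tpow_short (- n%:Z).
have [y [sy py ly]] := sweep_short (shift n%:Z u) (2 * n).+1.
have [z [sz pz lz]] := tpow_short (- n.+1%:Z).
exists (x * y * z)%g; split; last 2 first.
- by rewrite !posM px py pz; lia.
- rewrite !lampsM lx ly lz px shift_nolamp addl0 add0l.
  apply: funext => -[s i]; rewrite /shift /= opprK addrK.
  case: (boolP (u (s, i))) => [/nu /=|]; rewrite ?andbF //.
  by move=> ni; rewrite andbT; lia.
have sxyz := short_mul (short_mul sx sy) sz; apply: short_le sxyz.
by rewrite !abszN; lia.
Qed.

Lemma box_cen n c : (forall j, c j -> (2 ^ j <= 2 * n)%N) -> box n (0 : int, nolamp, c).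
Proof. by move=> cn; split. Qed.

Definition lg_cen n c (cn : forall j, c j -> (2 ^ j <= 2 * n)%N) : G :=
  mk_raw (box_cen cn).

(** All wanted [c_j] are written at once, as the commutator of b with an element [x] whose b-lamps
    sit at the sites [2 ^ j] with [c j]. This is the purpose of the b-lamps. *)
Lemma cen_short n c (cn : forall j, c j -> (2 ^ j <= 2 * n)%N) :
  short lg_gens (34 * n + 10) (lg_cen cn).
Proof.
pose u (p : bool * int) := [&& ~~ p.1, p.2 == (2 ^ trunc_log 2 `|p.2|)%N%:Z & c (trunc_log 2 `|p.2|)].
have u2 j : u (false, (2 ^ j)%N%:Z) = c j.
  by rewrite /u /= trunc_expnK // eqxx.
have un : bounded (2 * n) u by move=> [s i] /and3P[_ /eqP /= iE /cn]; lia.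
have [x [sx px lx]] := lamps_short un.
have -> : lg_cen cn = (lg_lamp false * x * (x * lg_lamp false)^-1)%g.
  apply: (mulIg (x * lg_lamp false)%g); rewrite mulgVK; apply: lg_ext.
  - by rewrite !posM px.
  - by rewrite !lampsM px lx !shift0 add0l addlC.
  rewrite !cenM !lampsM px lx !shift0; apply: funext => j.
  (* [A] pairs the lamps of [x], all at positive sites, with b at 0 and vanishes; [B] pairs b at 0
     with the b-lamp at [2 ^ j]. *)
  rewrite form0l !addbF; set A := form _ _ _ j; set B := form _ _ _ j.
  have -> : A = false.
    apply: negbTE; apply/negP => /form_ex [s [i [/and3P[_ /eqP /= iE _] /eqP[_]]]].
    have := gap_ge f s j; lia.
  have -> : B = c j.
    rewrite /B /form (@parity1 _ (false, 0)) /=.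
      by rewrite add0r u2.
    by move=> [s i] /andP[/eqP].
  by rewrite -[cen (lg_cen cn)]/c; case: (c j); case: (cen x j).
have slamp := short_gen (lg_gens_lamp false).
have s1 := short_mul slamp sx; have s2 := short_inv (short_mul sx slamp).
by apply: short_le (short_mul s1 s2); lia.
Qed.

(** The upper bound for the norm: [h] realises position and lamps with [9n + 4] letters. By
    [short_box] its central part is supported where [2 ^ j] is linear in [n], so [cen_short] repairs
    it at linear cost. *)
Lemma box_short n g : box n (val g) -> short lg_gens (400 * n.+1) g.
Proof.
move=> gn; have [pn ln cn] := gn; have [x [sx px lx]] := lamps_short ln.
have [y [sy py ly]] := tpow_short (pos g).
have sh : short lg_gens (9 * n + 4) (x * y)%g.
  by apply: short_le (short_mul sx sy); rewrite /pos; lia.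
have [_ _ ch] := short_box sh; set h := (x * y)%g in sh ch.
have dn j : cen g j (+) cen h j -> (2 ^ j <= 2 * (9 * n + 4))%N.
  by case: (boolP (cen g j)) => [/cn|_ /= /ch]; lia.
have -> : g = (lg_cen dn * h)%g.
  apply: lg_ext; first by rewrite !posM px py !add0r.
    by rewrite !lampsM shift0 lx ly shift_nolamp addl0 add0l.
  rewrite cenM form0l; apply: funext => j; rewrite addbF.
  by rewrite -[cen (lg_cen dn) j]/(cen g j (+) cen h j) -addbA addbb addbF.
by apply: short_le (short_mul (cen_short dn) sh); lia.
Qed.

Lemma lg_generates : generates lg_gens.
Proof.
by move=> g; have [n gn] := ex_box g; have [w Sw _] := box_short gn; exists w.
Qed.

End WordMetric.

Arguments lg_gens : clear implicits.

(** * Conjugacy in the group *)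

Section ConjugacyProblem.
Variable f : nat -> nat.
Hypothesis f_mono : forall m n, m <= n -> f m <= f n.
Local Open Scope ring_scope.
Local Notation G := (lampgroup f).
Implicit Types (u v w : bool * int -> bool) (k : int) (g h : G).

(** The sparseness of the gaps: beyond index [i] each gap is further by at least [2 ^ i]. *)
Lemma gap_lt s i j : (i < j)%N -> (gap f s i + 2 ^ i <= gap f s j)%N.
Proof.
move=> ij; have le2 : (2 ^ i + 2 ^ i <= 2 ^ j)%N.
  by rewrite addnn -mul2n -expnS leq_exp2l.
case: s => //=; have : (f (2 ^ i) <= f (2 ^ j))%N by apply: f_mono; lia.
lia.
Qed.

Lemma gap_le s i j : (i <= j)%N -> (gap f s i <= gap f s j)%N.
Proof. by rewrite leq_eqVlt => /orP[/eqP -> //|/(gap_lt s)]; lia. Qed.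

Lemma conjugatesE (h g1 g2 : G) : conjugates h g1 g2 <-> (h * g1 = g2 * h)%g.
Proof.
rewrite /conjugates; split => [<-|->]; first by rewrite mulgVK.
by rewrite mulgK.
Qed.

(** The equation [h * g1 = g2 * h] by components. The central part of [h] cancels, so conjugators
    can be taken with central part zero. *)
Lemma lg_conjP (h g1 g2 : G) : conjugates h g1 g2 <-> [/\ pos g1 = pos g2,
  addl (lamps h) (shift (pos h) (lamps g1)) = addl (lamps g2) (shift (pos g1) (lamps h)) &
  forall j, cen g1 j (+) cen g2 j = form f (lamps h) (shift (pos h) (lamps g1)) j (+)
    form f (lamps g2) (shift (pos g1) (lamps h)) j].
Proof.
rewrite conjugatesE; split => [E|[E1 E2 E3]].
  have E1 : pos g1 = pos g2 by have := congr1 (@pos f) E; rewrite !posM; lia.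
  split=> //; first by have := congr1 (@lamps f) E; rewrite !lampsM E1.
  move=> j; have := congr1 (fun g => cen g j) E; rewrite !cenM E1.
  by case: (cen h j); case: (cen g1 j); case: (cen g2 j); case: (form _ _ _ _); case: (form _ _ _ _).
apply: lg_ext; first by rewrite !posM E1 addrC.
  by rewrite !lampsM E2 E1.
rewrite !cenM; apply: funext => j; have := E3 j; rewrite E1.
by case: (cen h j); case: (cen g1 j); case: (cen g2 j); case: (form _ _ _ _); case: (form _ _ _ _).
Qed.

(** Multiplying [h] on the right by [g1] or its inverse keeps it a conjugator and moves its position
    by [pos g1]; while the position exceeds [L], one of the two brings it closer to 0. *)
Lemma conj_pos_le L h g1 g2 : conjugates h g1 g2 -> pos g1 != 0 -> (`|pos g1| <= L)%N ->
  exists2 h', conjugates h' g1 g2 & (`|pos h'| <= L)%N.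
Proof.
move=> hg k0 kL; have [N] := ubnP `|pos h|%N; elim: N h hg => // N IHN h hg hN.
have [hL|Lh] := leqP `|pos h|%N L; first by exists h.
have h1 : conjugates (h * g1)%g g1 g2.
  by rewrite conjugatesE; move/conjugatesE: hg => E; rewrite E -mulgA E.
have h2 : conjugates (h * g1^-1)%g g1 g2.
  rewrite conjugatesE mulgVK; move/conjugatesE: hg => E.
  by rewrite mulgA -E mulgK.
have : (`|pos (h * g1)%g| < `|pos h|)%N \/ (`|pos (h * g1^-1)%g| < `|pos h|)%N.
  by rewrite !posM -[pos g1^-1%g]/(- pos g1); lia.
by case=> lt; [apply: (IHN _ h1)|apply: (IHN _ h2)]; apply: leq_trans lt _.
Qed.

(* Outside [-M, M] the function w is k-periodic; having bounded support, it vanishes there. *)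
Lemma bounded_periodic n M k w : k != 0 -> bounded n w ->
  (forall s i, (M < `|i|)%N -> w (s, i) = w (s, i - k)) -> bounded M w.
Proof.
move=> k0 nw per [s i] wi; rewrite leqNgt; apply/negP => /= Mi.
have [d [d0 dE]] : exists d : int, (0 < d) /\ (d = k \/ d = - k) by case: (ltP 0 k); [exists k | exists (- k)]; lia.
have down j : (M < `|j|)%N -> 0 < j -> w (s, j) -> w (s, j + d).
  move=> Mj j0 wj; case: dE d0 => -> d0; last by rewrite -per.
  by rewrite per ?addrK //; lia.
have up j : (M < `|j|)%N -> j < 0 -> w (s, j) -> w (s, j - d).
  move=> Mj j0 wj; case: dE d0 => -> d0; first by rewrite -per.
  by rewrite per ?opprK ?addrK //; lia.
have far q : w (s, if 0 < i then i + d *+ q else i - d *+ q).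
  elim: q => [|q]; first by case: ifP; rewrite mulr0n ?subr0 ?addr0.
  have dq : 0 <= d *+ q by rewrite mulrn_wge0 // ltW.
  rewrite mulrS; case: ifP => i0 wq.
    by rewrite [d + _]addrC addrA; apply: down => //; lia.
  by rewrite opprD addrCA addrC; apply: up => //; lia.
have dn : n.+1%:Z <= d *+ n.+1 by rewrite -[n.+1%:Z]/(Posz n.+1) -mulr_natr; nia.
by have := nw _ (far n.+1); case: ifP => /=; lia.
Qed.

Definition truncl (r : bool -> nat) w : bool * int -> bool :=
  fun p => (`|p.2| <= r p.1)%N && w p.

(* Past index j0 the gaps are further apart than 2L, so a lamp at distance more than
   gap s j0 + L from the origin only interacts with [-L, L] through central
   coordinates beyond j0. *)
Lemma form_truncl L j0 u v w : (2 * L < 2 ^ j0)%N -> bounded L u -> bounded L v ->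
  let w' := truncl (fun s => gap f s j0 + L)%N w in
  forall j, form f w' u j (+) form f v w' j =
    if (j <= j0)%N then form f w u j (+) form f v w j else false.
Proof.
move=> Lj0 Lu Lv w' j; case: leqP => jj0; last first.
  have gj s : (gap f s j0 + 2 ^ j0 <= gap f s j)%N by apply: gap_lt.
  rewrite /form !parity0 // => -[s i] /=; apply: negbTE; apply/negP.
    by move=> /andP[/Lv /= vi /andP[/= wi _]]; have := gj s; lia.
  by move=> /andP[/andP[/= wi _] /Lu /= ui]; have := gj s; lia.
have gj s : (gap f s j <= gap f s j0)%N by apply: gap_le.
congr (_ (+) _); apply: eq_parity => -[s i]; rewrite /w' /truncl /=.
  case: (boolP (u _)) => [/Lu /= ui|]; rewrite ?andbF // !andbT.
  by case: (w _); rewrite ?andbF ?andbT //; have := gj s; lia.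
case: (boolP (v _)) => [/Lv /= vi|//] /=.
by case: (w _); rewrite ?andbF ?andbT //; have := gj s; lia.
Qed.

Lemma cen_box L g j0 j : (2 * L < 2 ^ j0)%N -> box L (val g) -> (j0 < j)%N -> cen g j = false.
Proof.
move=> Lj0 [_ _ gL] jj0; apply: negbTE; apply/negP => /gL.
have : (2 ^ j0 <= 2 ^ j)%N by rewrite leq_exp2l // ltnW.
lia.
Qed.

(** If [pos g1] is non-zero, a conjugator of small position has lamps confined by periodicity. If it
    is zero, the lamps of [g2] are a translate of those of [g1], which bounds the position of [h],
    and the far lamps of [h] are switched off. *)
Lemma conj_box L h g1 g2 j0 : (2 * L < 2 ^ j0)%N -> conjugates h g1 g2 ->
  box L (val g1) -> box L (val g2) ->
  exists2 h', conjugates h' g1 g2 & box (2 * L + gap f true j0) (val h').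
Proof.
move=> Lj0 hg b1 b2; have [p1L l1L _] := b1; have [p2L l2L _] := b2.
have [k0|k0] := eqVneq (pos g1) 0; last first.
  have [x xg xL] := conj_pos_le hg k0 p1L.
  have [n [_ nx _]] := ex_box x; have /lg_conjP[E1 E2 E3] := xg.
  have xb : bounded (2 * L) (lamps x).
    (* Beyond [2L] neither [g2] nor the translate of [g1] has a lamp, so the lamp equation says that
       [lamps x] is periodic there. *)
    apply: (bounded_periodic k0 nx) => s i iL.
    have := congr1 (fun u => u (s, i)) E2; rewrite /addl /shift /=.
    have -> : lamps g1 (s, i - pos x) = false by apply: negbTE; apply/negP => /l1L /=; lia.
    have -> : lamps g2 (s, i) = false by apply: negbTE; apply/negP => /l2L /=; lia.
    by rewrite addbF.
  have b : box (2 * L + gap f true j0) (pos x, lamps x, fun=> false).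
    by split => //=; [lia | apply: bounded_le xb; lia].
  by exists (mk_raw f b) => //; apply/lg_conjP.
have /lg_conjP[E1 E2 E3] := hg.
rewrite k0 shift0 addlC in E2.
have E4 : shift (pos h) (lamps g1) = lamps g2.
  by have := congr1 (addl (lamps h)) E2; rewrite [addl (lamps g2) _]addlC [addl (shift _ _) _]addlC !addlK.
rewrite E4 in E3.
(* With position 0 and no lamps [g1] is central, and the identity conjugates. *)
have [l10|/existsNP[[s i] gi]] := pselect (forall p, lamps g1 p = false).
  have l10' : lamps g1 = nolamp by apply: funext.
  have l20 : lamps g2 = nolamp by rewrite -E4 l10'.
  have b : box (2 * L + gap f true j0) (raw_one) by apply: box_one.
  exists (mk_raw f b); first apply/lg_conjP; last by [].
  split=> //; first by rewrite l10' l20 k0.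
  by move=> j; rewrite E3 l20 l10' k0 !form0l !form0r.
have hL : (`|pos h| <= 2 * L)%N.
  have := congr1 (fun u => u (s, i + pos h)) E4; rewrite /shift /= addrK.
  case: (boolP (lamps g1 (s, i))) gi => // gi _ /esym /l2L /=.
  by have := l1L _ gi => /=; lia.
pose w := truncl (fun s => gap f s j0 + L)%N (lamps h).
have b : box (2 * L + gap f true j0) (pos h, w, fun=> false).
  split => //=; first by lia.
  by move=> [[] l] /andP[/=]; lia.
exists (mk_raw f b) => //; apply/lg_conjP.
split=> //; first by rewrite E4 k0 shift0 addlC.
(* Up to [j0] truncation preserves the sum of the two forms; beyond [j0] both sides vanish. *)
move=> j; rewrite k0 shift0 -[pos _]/(pos h) -[lamps (mk_raw _ _)]/w E4.
rewrite (form_truncl _ Lj0) //; case: leqP => jj0; last by rewrite !(cen_box Lj0).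
by rewrite E3 k0 shift0.
Qed.

Lemma ex_exp L : exists j, (L < 2 ^ j <= 2 * L.+1)%N.
Proof.
exists (trunc_log 2 L.+1).+1.
have := @trunc_logP 2 L.+1 isT isT; have := @trunc_log_ltn 2 L.+1 isT.
by rewrite expnS; lia.
Qed.

(** * The two bounds on the conjugator length *)

Lemma lg_conj_length_upper :
  prec (fun n => n) f -> prec (conj_length (lg_gens f)) f.
Proof.
have genS := @lg_generates f; have finS := @lg_gens_finite f.
move=> [C CP]; exists (400 * (7 * C + 9))%N => L.
have [[g1 [g2 [[h hg] gL <-]]] _] := conj_lengthP L finS genS.
have b g : (word_norm (lg_gens f) g <= L)%N -> box L (val g).
  by move=> /(word_norm_le genS) /short_box.
have [j /andP[j1 j2]] := ex_exp (2 * L).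
have [x xg /box_short xs] := conj_box j1 hg (b g1 ltac:(lia)) (b g2 ltac:(lia)).
have [_ /(_ _ xg)] := conj_distP (lg_gens f) (ex_intro _ h hg).
move=> /leq_trans; apply; apply/(word_norm_le genS); apply: short_le xs.
(* The conjugator has norm at most [400 * (2L + f (2 ^ j) + 2 ^ j + 1)]; the linear terms are
   absorbed by [L <= C * f (C * L + C) + C]. *)
rewrite /gap; set K := (400 * (7 * C + 9))%N; have := CP L.
have : (f (2 ^ j) <= f (K * L + K))%N by apply: f_mono; rewrite /K; nia.
have : (f (C * L + C) <= f (K * L + K))%N by apply: f_mono; rewrite /K; nia.
move: (f (K * L + K)) (f (2 ^ j)) (f (C * L + C)) (2 ^ j)%N j2 => A B D E EL.
rewrite /K; nia.
Qed.

(** For [n < 2 ^ j <= 2n + 2] the elements [a] and [c_j * a] have norm linear in [n], while every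
    conjugator has an a-lamp at distance [gap f true j >= f n] from the origin. *)
Lemma lg_conj_length_lower : prec f (conj_length (lg_gens f)).
Proof.
have genS := @lg_generates f; have finS := @lg_gens_finite f.
exists 100%N => n; have [j /andP[j1 j2]] := ex_exp n.
(* The norms of the pair add up to at most [1 + 34 * (2n + 2) + 11 <= 100n + 100]. *)
apply: leq_trans (_ : conj_length (lg_gens f) (100 * n + 100) <= _)%N; last by move: (conj_length _ _) => q; lia.
pose c := pred1 j : nat -> bool.
have cj i : c i -> (2 ^ i <= 2 * 2 ^ j)%N by move=> /eqP ->; lia.
pose z := lg_cen f cj; pose a := lg_lamp f true.
have sa : short (lg_gens f) 1 a := short_gen (lg_gens_lamp _ _).
have sza := short_mul (cen_short f cj) sa.
have bw : box (gap f true j) (0 : int, unit_lamp true (gap f true j)%:Z, fun=> false).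
  by split => // p /eqP -> /=.
have g0 : (0 < gap f true j)%N by have := gap_ge f true j; lia.
have form1 v w p : (forall q, v q && w (q.1, q.2 + (gap f q.1 j)%:Z) -> q = p) ->
    v p -> w (p.1, p.2 + (gap f p.1 j)%:Z) -> form f v w j.
  by move=> vw vp wp; rewrite /form (parity1 vw) vp wp.
have conj_aza : conjugates (mk_raw f bw) a (z * a)%g.
  apply/lg_conjP; split => //.
    rewrite -[lamps (z * a)%g]/(addl nolamp (shift 0 (unit_lamp true 0))).
    by rewrite !shift0 add0l addlC.
  move=> i; rewrite -[lamps (z * a)%g]/(addl nolamp (shift 0 (unit_lamp true 0))).
  rewrite -[pos _]/(0 : int) !shift0 add0l.
  rewrite -[lamps a]/(unit_lamp true 0) -[lamps (mk_raw _ _)]/(unit_lamp true (gap f true j)).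
  rewrite cenM -[cen a i]/false -[cen z i]/(i == j) form0l !addbF /=.
  have -> : form f (unit_lamp true (gap f true j)%:Z) (unit_lamp true 0) i = false.
    apply: negbTE; apply/negP => /form_ex[s [l [/eqP[_ ->] /eqP[_]]]]; lia.
  have [->|ij] := eqVneq i j.
    rewrite (form1 _ _ (true, 0)) //=.
      by move=> q /andP[/eqP].
    by rewrite /unit_lamp /= add0r eqxx.
  (* The gaps of the a-lamps are pairwise distinct, so no coordinate other than [j] changes. *)
  apply/esym; apply: negbTE; apply/negP => /form_ex[s [l [/eqP[-> ->] /eqP[]]]].
  case: (ltngtP i j) ij => // /(gap_lt true); rewrite [gap]lock /= -lock /gap => lt _.
    by have := expn_gt0 2 i; lia.
  by have := expn_gt0 2 j; lia.
have caza : conjugate a (z * a)%g by exists (mk_raw f bw).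
have [[x xaz xd] _] := conj_distP (lg_gens f) caza.
have fx : (f n <= conj_dist (lg_gens f) a (z * a)%g)%N.
  rewrite -xd; have [_ bx _] := short_box (word_norm_spec genS x).
  apply: leq_trans (_ : gap f true j <= _)%N.
    by rewrite /gap; apply: leq_trans (f_mono (ltnW j1)) _; apply: leq_addr.
  have /lg_conjP[_ E2 E3] := xaz; have := E3 j.
  rewrite -[lamps (z * a)%g]/(addl nolamp (shift 0 (unit_lamp true 0))) shift0 add0l.
  rewrite -[pos a]/(0 : int) shift0 cenM -[cen a j]/false -[cen z j]/(j == j) eqxx form0l /=.
  rewrite -[lamps a]/(unit_lamp true 0) shift_unit add0r.
  (* The lamps of [x] cancel in the lamp equation, leaving the lamp at [pos x] equal to the lamp at
     0. *)
  have p0 : pos x = 0.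
    move: E2; rewrite -[lamps (z * a)%g]/(addl nolamp (shift 0 (unit_lamp true 0))).
    rewrite -[pos a]/(0 : int) !shift0 add0l -[lamps a]/(unit_lamp true 0).
    rewrite shift_unit add0r addlC => E.
    have := congr1 (addl (lamps x)) E; rewrite [addl (unit_lamp true (pos x)) _]addlC.
    rewrite [addl (unit_lamp true 0) _]addlC !addlK.
    by move/(congr1 (fun u => u (true, pos x))); rewrite /unit_lamp /= eqxx => /esym/eqP[].
  (* Exactly one of the two forms is true at [j]: the first yields an a-lamp of [x] at [-gap], the
     second one at [gap]. *)
  rewrite p0 => /esym; case: (boolP (form f (lamps x) _ j)) => [|_ /=].
    by move=> /form_ex[s [l [/bx /= lx /eqP[-> lg]]]] _; move: lx lg; rewrite /gap; lia.
  by move=> /form_ex[s [l [/eqP[-> ->] /bx /=]]]; rewrite /gap /=; lia.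
apply: leq_trans fx _; have [_] := conj_lengthP (100 * n + 100) finS genS; apply=> //.
have : (word_norm (lg_gens f) a <= 1)%N by apply/word_norm_le.
have : (word_norm (lg_gens f) (z * a)%g <= 34 * 2 ^ j + 10 + 1)%N by apply/word_norm_le.
move: (2 ^ j)%N j2 => E; lia.
Qed.

Lemma lg_conj_length : prec (fun n => n) f -> conj_length_simeq G f.
Proof.
move=> nf; apply: (@conj_length_simeq_gen _ (lg_gens f)).
- by move=> m n; apply: f_mono.
- exact: lg_gens_finite.
- exact: lg_generates.
- by split; [apply: lg_conj_length_upper | apply: lg_conj_length_lower].
Qed.

End ConjugacyProblem.

(** * Recursive functions *)

Section Recursive.
Implicit Types (k m : nat) (g h : seq nat -> nat).

(** Lists instead of tuples keep arities out of the types of the functions; only values on lists of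
    length [k] count. *)
Definition recursive k g := exists c : rec_code k, forall x : k.-tuple nat, rec_graph c x (g x).

Lemma eq_recursive k g h : (forall x, size x = k -> g x = h x) -> recursive k g -> recursive k h.
Proof. by move=> gh [c cg]; exists c => x; rewrite -gh ?size_tuple. Qed.

Lemma recursive_nth k i : i < k -> recursive k (fun x => nth 0 x i).
Proof. by move=> ik; exists (RProj (Ordinal ik)) => x /=; rewrite (tnth_nth 0). Qed.

Lemma recursive_mkseq k m h (g : nat -> seq nat -> nat) :
  recursive m h -> (forall i, i < m -> recursive k (g i)) ->
  recursive k (fun x => h (mkseq (g^~ x) m)).
Proof.
move=> [c ch] gr; have /choice[d dP] : forall i : 'I_m, exists d : rec_code k,
    forall x : k.-tuple nat, rec_graph d x (g i x) by move=> i; apply: gr.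
exists (RComp c d) => x; exists (mktuple (fun i : 'I_m => g i x)); split.
  by move=> i; rewrite tnth_mktuple.
have -> : mkseq (g^~ x) m = mktuple (fun i : 'I_m => g i x); last exact: ch.
by rewrite /mkseq -val_enum_ord -map_comp.
Qed.

Lemma recursive_comp1 (h : nat -> nat) k g :
  recursive 1 (fun x => h (nth 0 x 0)) -> recursive k g -> recursive k (fun x => h (g x)).
Proof. by move=> hr gr; apply: (recursive_mkseq (g := fun _ => g) hr). Qed.

Lemma recursive_comp2 (h : nat -> nat -> nat) k g1 g2 :
  recursive 2 (fun x => h (nth 0 x 0) (nth 0 x 1)) ->
  recursive k g1 -> recursive k g2 -> recursive k (fun x => h (g1 x) (g2 x)).
Proof.
move=> hr gr1 gr2; apply: (recursive_mkseq (g := nth g1 [:: g1; g2]) hr).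
by case=> [|[]].
Qed.

Lemma recursive_comp3 (h : nat -> nat -> nat -> nat) k g1 g2 g3 :
  recursive 3 (fun x => h (nth 0 x 0) (nth 0 x 1) (nth 0 x 2)) ->
  recursive k g1 -> recursive k g2 -> recursive k g3 ->
  recursive k (fun x => h (g1 x) (g2 x) (g3 x)).
Proof.
move=> hr gr1 gr2 gr3; apply: (recursive_mkseq (g := nth g1 [:: g1; g2; g3]) hr).
by case=> [|[|[]]].
Qed.

Lemma recursive_comp4 (h : nat -> nat -> nat -> nat -> nat) k g1 g2 g3 g4 :
  recursive 4 (fun x => h (nth 0 x 0) (nth 0 x 1) (nth 0 x 2) (nth 0 x 3)) ->
  recursive k g1 -> recursive k g2 -> recursive k g3 -> recursive k g4 ->
  recursive k (fun x => h (g1 x) (g2 x) (g3 x) (g4 x)).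
Proof.
move=> hr gr1 gr2 gr3 gr4; apply: (recursive_mkseq (g := nth g1 [:: g1; g2; g3; g4]) hr).
by case=> [|[|[|[]]]].
Qed.

Lemma recursive_succ k g : recursive k g -> recursive k (fun x => (g x).+1).
Proof.
by apply: recursive_comp1; exists RSucc => x /=; rewrite /thead (tnth_nth 0).
Qed.

Lemma recursive_const k n : recursive k (fun=> n).
Proof.
elim: n => [|n IHn]; last exact: recursive_succ.
have [] := @recursive_mkseq k 0 (fun=> 0) (fun _ _ => 0) => //.
  by exists RZero.
by move=> c; exists c.
Qed.

Lemma recursive_behead n k i : n + i < k -> recursive k (fun x => nth 0 (iter n behead x) i).
Proof.
move=> nik; apply: eq_recursive (recursive_nth nik) => x _.
elim: n x {nik} => [//|n IHn] x; rewrite iterSr -IHn nth_behead.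
by rewrite addSn.
Qed.

(** [RPrim] puts counter and previous value before the parameters, so the step reads entries 0 and 1
    and the rest after two [behead]s. The recursion runs on an extra first argument, for which [n x]
    is then substituted. *)
Lemma recursive_iteri k (st : seq nat -> nat -> nat -> nat) n b :
  recursive k n -> recursive k.+2 (fun y => st (behead (behead y)) (nth 0 y 0) (nth 0 y 1)) ->
  recursive k b -> recursive k (fun x => iteri (n x) (st x) (b x)).
Proof.
move=> nr [d dst] [c cb].
have pr : recursive k.+1 (fun y => iteri (nth 0 y 0) (st (behead y)) (b (behead y))).
  exists (RPrim c d) => y; exists (fun i => iteri i (st (behead y)) (b (behead y))).
  rewrite /thead (tnth_nth 0); split=> [|i _|//]; first exact: (cb [tuple of behead y]).
  exact: (dst [tuple of [:: i, _ & behead y]]).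
pose g i := if i is j.+1 then (fun x => nth 0 x j) else n.
have := @recursive_mkseq k k.+1 _ g pr; case=> [i|c' c'P].
  by case: i => [//|i] /= ik; apply: recursive_nth.
exists c' => x; have := c'P x; suff -> : mkseq (g^~ x) k.+1 = n x :: x by [].
apply: (@eq_from_nth _ 0); rewrite size_mkseq /= ?size_tuple // => i ik.
by rewrite nth_mkseq //; case: i ik.
Qed.

End Recursive.

Ltac rec_var := first [exact: recursive_const | exact: recursive_nth
  | exact: (@recursive_behead 1) | exact: (@recursive_behead 2)].

(** * Arithmetic, bounded sums and decoding of lists *)

Section RecursiveArith.
Implicit Types (k m : nat) (g h : seq nat -> nat).

Lemma recursiveD k g h : recursive k g -> recursive k h -> recursive k (fun x => g x + h x).
Proof.
apply: recursive_comp2.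
apply: (@eq_recursive _ (fun x => iteri (nth 0 x 0) (fun _ s => s.+1) (nth 0 x 1))).
  by move=> x _; elim: (nth 0 x 0) => //= n ->.
by apply: recursive_iteri; [rec_var | apply: recursive_succ; rec_var | rec_var].
Qed.

Lemma recursiveM k g h : recursive k g -> recursive k h -> recursive k (fun x => g x * h x).
Proof.
apply: recursive_comp2.
apply: (@eq_recursive _ (fun x => iteri (nth 0 x 0) (fun _ s => nth 0 x 1 + s) 0)).
  by move=> x _; elim: (nth 0 x 0) => //= n ->; rewrite mulSn.
by apply: recursive_iteri; [rec_var | apply: recursiveD; rec_var | rec_var].
Qed.

Lemma recursive_exp k g h : recursive k g -> recursive k h -> recursive k (fun x => g x ^ h x).
Proof.
apply: recursive_comp2.
apply: (@eq_recursive _ (fun x => iteri (nth 0 x 1) (fun _ s => nth 0 x 0 * s) 1)).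
  by move=> x _; elim: (nth 0 x 1) => //= n ->; rewrite expnS.
by apply: recursive_iteri; [rec_var | apply: recursiveM; rec_var | rec_var].
Qed.

Lemma recursive_pred k g : recursive k g -> recursive k (fun x => (g x).-1).
Proof.
apply: (@recursive_comp1 predn).
apply: (@eq_recursive _ (fun x => iteri (nth 0 x 0) (fun i _ => i) 0)).
  by move=> x _; case: (nth 0 x 0).
by apply: recursive_iteri; rec_var.
Qed.

Lemma recursiveB k g h : recursive k g -> recursive k h -> recursive k (fun x => g x - h x).
Proof.
apply: recursive_comp2.
apply: (@eq_recursive _ (fun x => iteri (nth 0 x 1) (fun _ s => s.-1) (nth 0 x 0))).
  by move=> x _; elim: (nth 0 x 1) => [|n /= ->]; rewrite ?subn0 ?subnS.
by apply: recursive_iteri; [rec_var | apply: recursive_pred; rec_var | rec_var].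
Qed.

Lemma recursive_eq k g h : recursive k g -> recursive k h ->
  recursive k (fun x => nat_of_bool (g x == h x)).
Proof.
apply: (@recursive_comp2 (fun a b => nat_of_bool (a == b))).
apply: (@eq_recursive _ (fun x => 1 - ((nth 0 x 0 - nth 0 x 1) + (nth 0 x 1 - nth 0 x 0)))).
  by move=> x _; case: eqP => [->|]; lia.
by apply: recursiveB; [rec_var | apply: recursiveD; apply: recursiveB; rec_var].
Qed.

Lemma recursive_odd k g : recursive k g -> recursive k (fun x => nat_of_bool (odd (g x))).
Proof.
apply: (@recursive_comp1 (fun a => nat_of_bool (odd a))).
apply: (@eq_recursive _ (fun x => iteri (nth 0 x 0) (fun _ s => 1 - s) 0)).
  by move=> x _; elim: (nth 0 x 0) => //= n ->; case: (odd n).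
by apply: recursive_iteri; [rec_var | apply: recursiveB; rec_var | rec_var].
Qed.

Lemma recursive_sum k (F : seq nat -> nat -> nat) n :
  recursive k n -> recursive k.+1 (fun y => F (behead y) (nth 0 y 0)) ->
  recursive k (fun x => \sum_(0 <= i < n x) F x i).
Proof.
move=> nr Fr; apply: (@eq_recursive _ (fun x => iteri (n x) (fun i s => s + F x i) 0)).
  by move=> x _; elim: (n x) => [|i /= ->]; [rewrite big_geq | rewrite big_nat_recr].
apply: recursive_iteri => //; last by rec_var.
apply: recursiveD; first by rec_var.
(* [p] skips entry 1, the accumulator, so that [F] receives the index and the parameters. *)
pose p i (y : seq nat) := if i is j.+1 then nth 0 (behead (behead y)) j else nth 0 y 0.
have pr i : i < k.+1 -> recursive k.+2 (p i).
  case: i => [_|i ik]; first by rec_var.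
  exact: (@recursive_behead 2).
apply: eq_recursive (recursive_mkseq Fr pr) => y yk.
suff -> : mkseq (p^~ y) k.+1 = nth 0 y 0 :: behead (behead y) by [].
apply: (@eq_from_nth _ 0); rewrite size_mkseq /= ?size_behead ?yk // => i ik.
by rewrite nth_mkseq //; case: i ik.
Qed.

End RecursiveArith.

Ltac rec_step := first [rec_var | apply: recursive_succ | apply: recursiveD
  | apply: recursiveM | apply: recursive_exp | apply: recursiveB | apply: recursive_eq
  | apply: recursive_odd | apply: recursive_sum].

(** The list [a :: s] has code [2 ^ a * (2b + 1)], where [b] is the code of [s]. The double sum is a
    bounded search for the unique such pair and gives 0 on the empty list. *)
Definition code_head m := \sum_(0 <= a < m) \sum_(0 <= b < m) a * (2 ^ a * (b + b).+1 == m).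

Definition code_behead m := \sum_(0 <= a < m) \sum_(0 <= b < m) b * (2 ^ a * (b + b).+1 == m).

Definition code_drop m i := iteri i (fun _ => code_behead) m.

(* The i-th entry of the sequence with code m, increased by 1; 0 past the end. *)
Definition code_nth m i := (code_head (code_drop m i)).+1 * (1 - (code_drop m i == 0)).

Lemma recursive_code_nth k g h : recursive k g -> recursive k h ->
  recursive k (fun x => code_nth (g x) (h x)).
Proof.
apply: recursive_comp2.
have drop_rec : recursive 2 (fun x => code_drop (nth 0 x 0) (nth 0 x 1)).
  apply: recursive_iteri; [rec_var | | rec_var].
  apply: (@recursive_comp1 code_behead); last by rec_var.
  by rewrite /code_behead; do ![rec_step].
apply: recursiveM; last by apply: recursiveB; [rec_var | apply: recursive_eq => //; rec_var].
apply: recursive_succ; apply: (@recursive_comp1 code_head) drop_rec.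
by rewrite /code_head; do ![rec_step].
Qed.

Lemma sum_code (F : nat -> nat -> nat) a b m : m = 2 ^ a * (b + b).+1 ->
  \sum_(0 <= a' < m) \sum_(0 <= b' < m) F a' b' * (2 ^ a' * (b' + b').+1 == m) = F a b.
Proof.
move=> mE; have am : a < m.
  by rewrite mE; apply: leq_trans (ltn_expl a (ltnSn 1)) _; rewrite leq_pmulr.
have bm : b < m by rewrite mE; have := expn_gt0 2 a; nia.
have inj a' b' : 2 ^ a' * (b' + b').+1 = m -> a' = a /\ b' = b.
  move=> E; have : [:: a'; b'] = [:: a; b].
    suff [-> ->] : a' = a /\ b' = b by [].
    have aE : a' = a.
      (* The 2-adic valuation recovers the exponent. *)
      have lg c d : logn 2 (2 ^ c * (d + d).+1) = c.
        rewrite lognM ?expn_gt0 // pfactorK // lognE /= dvdn2 /= addnn odd_double /=.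
        by rewrite addn0.
      by rewrite -(lg a' b') E mE lg.
    split=> //; have := E; rewrite aE mE => /eqP; rewrite eqn_pmul2l ?expn_gt0 // => /eqP; lia.
  by case.
under eq_bigr do rewrite big_mkord; rewrite big_mkord.
rewrite (bigD1 (Ordinal am)) //= (bigD1 (Ordinal bm)) //= -mE eqxx muln1.
rewrite !big1 ?addn0 // => [a' aa'|b' bb'].
  rewrite big1 // => b' _; case: eqP => [/inj[E _]|]; last by rewrite muln0.
  by move/eqP: aa'; case; apply: val_inj.
case: eqP => [/inj[_ E]|]; last by rewrite muln0.
by move/eqP: bb'; case; apply: val_inj.
Qed.

Lemma code_headE a s : code_head (CodeSeq.code (a :: s)) = a.
Proof. by apply: (@sum_code (fun a _ => a) _ (CodeSeq.code s)); rewrite /= addnn. Qed.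

Lemma code_beheadE a s : code_behead (CodeSeq.code (a :: s)) = CodeSeq.code s.
Proof. by apply: (@sum_code (fun _ b => b) a); rewrite /= addnn. Qed.

Lemma code_dropE s i : code_drop (CodeSeq.code s) i = CodeSeq.code (drop i s).
Proof.
elim: i => [|i IHi]; first by rewrite drop0.
rewrite /code_drop /= -/(code_drop _ _) {}IHi.
elim: s i => [|a s IHs] [|i] //=; try by rewrite /code_behead big_geq.
by rewrite drop0 -/(CodeSeq.code (a :: s)) code_beheadE.
Qed.

Lemma code_nthE s i :
  code_nth (CodeSeq.code s) i = if i < size s then (nth 0 s i).+1 else 0.
Proof.
rewrite /code_nth code_dropE; case: ltnP => [lt|ge]; last by rewrite drop_oversize /= ?muln0.
rewrite (drop_nth 0 lt) code_headE; suff -> : (CodeSeq.code (nth 0 s i :: drop i.+1 s) == 0) = false.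
  by rewrite muln1.
by rewrite /= muln_eq0 expn_eq0.
Qed.

(** Lets a code serve as the bound on positions in the sums below. *)
Lemma size_code s : size s <= CodeSeq.code s.
Proof.
elim: s => //= a s IHs; have := expn_gt0 2 a; nia.
Qed.

(** Minimisation over a dummy first argument stops at 0 when [g n = 0] and diverges otherwise. *)
Lemma rec_enumerable_zero g : recursive 1 (fun x => g (nth 0 x 0)) ->
  rec_enumerable [set n | g n = 0].
Proof.
move=> gr; have [c cP] : recursive 2 (fun x => g (nth 0 x 1)).
  by apply: recursive_comp1 gr _; rec_var.
exists (RMu c) => n; split=> [gn|[y [cy _]]].
  by exists 0; split=> //; have := cP [tuple of 0 :: [tuple n]]; rewrite /= gn.
exact: rec_graph_fun (cP [tuple of y :: [tuple n]]) cy.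
Qed.

(** * The word problem and the presentation *)

Section WordProblem.
Variable f : nat -> nat.

(* Letters are numbered as by [word_code], increased by 1: 1 and 2 for a and its inverse,
   3 and 4 for b, 5 and 6 for t. *)
Definition is_lamp (s : bool) (e : nat) : nat :=
  if s then (e == 1) + (e == 2) else (e == 3) + (e == 4).

Definition occ m i e : nat := \sum_(0 <= j < i) (code_nth m j == e).

(* Whether the positions x, y reached after l and j letters satisfy x + d = y. *)
Definition offset m l j d : bool :=
  occ m l 5 + d + occ m j 6 == occ m j 5 + occ m l 6.

(** How often the word toggles the lamp of type [s] at the position reached after [j] letters. *)
Definition visits m s j : nat :=
  \sum_(0 <= l < m) is_lamp s (code_nth m l) * offset m l j 0.

(** Counts the earlier and later lamp letters of type [s] whose positions differ by the gap; the
    parities for both types add up to the central coordinate [n]. *)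
Definition crossings m i s n : nat :=
  \sum_(0 <= j < i) \sum_(0 <= l < j)
    is_lamp s (code_nth m j) * (is_lamp s (code_nth m l) * offset m l j (gap f s n)).

(** The summands vanish when, in this order, all letters are valid, the position is 0, all visited
    lamps are off, and the central part is trivial. *)
Definition word_problem m : nat :=
  \sum_(0 <= i < m) (7 - code_nth m i == 0) + (1 - (occ m m 5 == occ m m 6)) +
  \sum_(0 <= j < m) (odd (visits m true j) + odd (visits m false j)) +
  \sum_(0 <= n < (m + m).+1) odd (crossings m m true n + crossings m m false n).

Lemma computable_recursive : computable f -> recursive 1 (fun x => f (nth 0 x 0)).
Proof.
move=> [c cP]; exists c => x.
have -> : x = [tuple nth 0 x 0] by apply: val_inj; case: x => [[|a []]].
exact/cP.
Qed.

Lemma recursive_gap s k g : computable f -> recursive k g ->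
  recursive k (fun x => gap f s (g x)).
Proof.
move=> /computable_recursive fr gr; case: s; rewrite /gap; last first.
  by apply: recursive_exp => //; apply: recursive_const.
apply: recursiveD; last by apply: recursive_exp => //; apply: recursive_const.
by apply: (recursive_comp1 fr); apply: recursive_exp => //; apply: recursive_const.
Qed.

Lemma recursive_is_lamp s k g : recursive k g -> recursive k (fun x => is_lamp s (g x)).
Proof.
by move=> gr; case: s; apply: recursiveD; apply: recursive_eq => //; apply: recursive_const.
Qed.

Lemma recursive_occ k g1 g2 g3 : recursive k g1 -> recursive k g2 -> recursive k g3 ->
  recursive k (fun x => occ (g1 x) (g2 x) (g3 x)).
Proof.
apply: recursive_comp3; apply: recursive_sum; first by rec_var.
by apply: recursive_eq; [apply: recursive_code_nth |]; rec_var.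
Qed.

Lemma recursive_offset k g1 g2 g3 g4 :
  recursive k g1 -> recursive k g2 -> recursive k g3 -> recursive k g4 ->
  recursive k (fun x => nat_of_bool (offset (g1 x) (g2 x) (g3 x) (g4 x))).
Proof.
apply: (@recursive_comp4 (fun a b c d => nat_of_bool (offset a b c d))).
by apply: recursive_eq; do ?[apply: recursiveD]; do ?[apply: recursive_occ]; rec_var.
Qed.

Lemma recursive_visits s k g1 g2 : recursive k g1 -> recursive k g2 ->
  recursive k (fun x => visits (g1 x) s (g2 x)).
Proof.
apply: (@recursive_comp2 (fun m j => visits m s j)).
apply: recursive_sum; first by rec_var.
apply: recursiveM; last by apply: recursive_offset; rec_var.
by apply: recursive_is_lamp; apply: recursive_code_nth; rec_var.
Qed.

Lemma recursive_crossings s k g1 g2 g3 : computable f ->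
  recursive k g1 -> recursive k g2 -> recursive k g3 ->
  recursive k (fun x => crossings (g1 x) (g2 x) s (g3 x)).
Proof.
move=> fc; apply: (@recursive_comp3 (fun m i n => crossings m i s n)).
apply: recursive_sum; first by rec_var.
apply: recursive_sum; first by rec_var.
apply: recursiveM; first by apply: recursive_is_lamp; apply: recursive_code_nth; rec_var.
apply: recursiveM; first by apply: recursive_is_lamp; apply: recursive_code_nth; rec_var.
by apply: recursive_offset; try rec_var; apply: recursive_gap => //; rec_var.
Qed.

Lemma recursive_word_problem : computable f -> recursive 1 (fun x => word_problem (nth 0 x 0)).
Proof.
move=> fc; apply: recursiveD; first apply: recursiveD; first apply: recursiveD.
- apply: recursive_sum; first by rec_var.
  apply: recursive_eq; last by rec_var.
  by apply: recursiveB; [rec_var | apply: recursive_code_nth; rec_var].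
- apply: recursiveB; first by rec_var.
  by apply: recursive_eq; apply: recursive_occ; rec_var.
- apply: recursive_sum; first by rec_var.
  by apply: recursiveD; apply: recursive_odd; apply: recursive_visits; rec_var.
apply: recursive_sum; first by apply: recursive_succ; apply: recursiveD; rec_var.
by apply: recursive_odd; apply: recursiveD; apply: recursive_crossings => //; rec_var.
Qed.

Local Open Scope ring_scope.
Local Notation G := (lampgroup f).

Definition letter_lamps e : bool * int -> bool := fun p => odd (is_lamp p.1 e) && (p.2 == 0).

Lemma odd_is_lamp e : odd (is_lamp true e) && odd (is_lamp false e) = false.
Proof. by case: e => [|[|[|[|[|e]]]]]. Qed.

(** A letter carries at most one lamp, so the form reads at most one lamp of [u]. *)
Lemma form_letter u k e n : form f u (shift k (letter_lamps e)) n =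
  (odd (is_lamp true e) && u (true, k - (gap f true n)%:Z)) (+)
  (odd (is_lamp false e) && u (false, k - (gap f false n)%:Z)).
Proof.
have eq0 (i d : int) : (i + d - k == 0) = (i == k - d) by lia.
have point s : odd (is_lamp s e) -> odd (is_lamp (~~ s) e) = false ->
    form f u (shift k (letter_lamps e)) n = u (s, k - (gap f s n)%:Z).
  move=> se nse; rewrite /form (@parity1 _ (s, k - (gap f s n)%:Z)).
    by rewrite /shift /letter_lamps /= se eq0 eqxx !andbT.
  move=> [s' i] /= /andP[_ /andP[/= s'e]]; rewrite eq0 => /eqP ->.
  case: (eqVneq s' s) => [-> //|ne]; have s'E : s' = ~~ s by case: (s') (s) ne => [] [].
  by rewrite -s'E s'e in nse.
have := odd_is_lamp e.
case: (boolP (odd (is_lamp true e))) => [te fe|te _] /=.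
  by move: fe => /= fe; rewrite (point true) // fe addbF.
case: (boolP (odd (is_lamp false e))) => [fe|fe] /=; first by rewrite (point false) //; apply/negbTE.
by apply: parity0 => -[[] i]; rewrite /shift /letter_lamps /= ?(negbTE te) ?(negbTE fe) /= andbF.
Qed.

Lemma word_eval_cat (H : groupType) k (x : 'I_k -> H) v w :
  word_eval x (v ++ w) = (word_eval x v * word_eval x w)%g.
Proof. by rewrite /word_eval big_cat. Qed.

Definition letter_eval (l : 'I_3 * bool) : G := if l.2 then (lg_gen f l.1)^-1%g else lg_gen f l.1.

Lemma letter_evalE l : let e := ((nat_of_ord l.1).*2 + nat_of_bool l.2).+1%N in
  [/\ pos (letter_eval l) = (e == 5%N)%:Z - (e == 6%N)%:Z,
      lamps (letter_eval l) = letter_lamps e & cen (letter_eval l) = fun=> false].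
Proof.
rewrite /letter_eval; case: l => [[[|[|[|i]]] i3] b] //=; rewrite /lg_gen /=.
- rewrite lg_lampV if_same; case: b; split => //; apply: funext => -[[] j] //=;
    by rewrite /letter_lamps /= -[lamps _]/(unit_lamp true 0) /unit_lamp /= xpair_eqE /=.
- rewrite lg_lampV if_same; case: b; split => //; apply: funext => -[[] j] //=;
    by rewrite /letter_lamps /= -[lamps _]/(unit_lamp false 0) /unit_lamp /= xpair_eqE /=.
case: b; split => //; try by apply: funext => -[[] j].
by apply: funext => j; rewrite -[cen _ j]/(form f nolamp nolamp j) form0l.
Qed.

Section Word.
Variable w : word 3.
Let m := word_code w.
Let P i : G := word_eval (lg_gen f) (take i w).

(** Past the end of [w] the entry is 0, which is no letter, and [E] is 1; hence the formulas for
    prefixes hold for every [i]. *)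
Lemma prefixS i : exists E : G, [/\ P i.+1 = (P i * E)%g,
  pos E = (code_nth m i == 5%N)%:Z - (code_nth m i == 6%N)%:Z,
  lamps E = letter_lamps (code_nth m i) & cen E = fun=> false].
Proof.
rewrite /m /word_code code_nthE size_map /P; case: ltnP => [iw|wi]; last first.
  exists 1%g; split => //; first by rewrite mulg1 !take_oversize // ltnW.
  by apply: funext => -[[] j].
case: w iw => // l0 w' iw; set w1 := l0 :: w' in iw *.
exists (letter_eval (nth l0 w1 i)); rewrite (nth_map l0) //.
have [-> -> ->] := letter_evalE (nth l0 w1 i); split=> //.
by rewrite (take_nth l0) // -cats1 word_eval_cat; congr (_ * _)%g; rewrite /word_eval big_seq1.
Qed.

Lemma prefix_pos i : pos (P i) = (occ m i 5)%:Z - (occ m i 6)%:Z.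
Proof.
elim: i => [|i IHi]; first by rewrite /P take0 /word_eval big_nil /occ !big_geq.
have [E [-> pE _ _]] := prefixS i; rewrite posM IHi pE /occ !big_nat_recr //=; lia.
Qed.

Lemma offsetE l j d : offset m l j d = (pos (P l) == pos (P j) - d%:Z).
Proof.
rewrite !prefix_pos /offset; move: (occ m l 5) (occ m l 6) (occ m j 5) (occ m j 6) => a b c e; lia.
Qed.

Lemma prefix_lamps i s x : lamps (P i) (s, x) =
  odd (\sum_(0 <= l < i) is_lamp s (code_nth m l) * (pos (P l) == x)).
Proof.
elim: i => [|i IHi]; first by rewrite /P take0 /word_eval big_nil big_geq.
have [E [-> _ lE _]] := prefixS i.
rewrite lampsM /addl IHi big_nat_recr //= oddD oddM oddb lE /shift /letter_lamps /=.
by congr (_ (+) (_ && _)); lia.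
Qed.

Lemma prefix_lamps_offset i s j d : lamps (P i) (s, pos (P j) - d%:Z) =
  odd (\sum_(0 <= l < i) is_lamp s (code_nth m l) * offset m l j d).
Proof. by rewrite prefix_lamps; under eq_bigr do rewrite -offsetE. Qed.

Lemma crossingsS i s n : crossings m i.+1 s n = (crossings m i s n + is_lamp s (code_nth m i) *
  \sum_(0 <= l < i) is_lamp s (code_nth m l) * offset m l i (gap f s n))%N.
Proof. by rewrite /crossings big_nat_recr //= big_distrr. Qed.

Lemma prefix_cen i n : cen (P i) n = odd (crossings m i true n + crossings m i false n).
Proof.
elim: i => [|i IHi].
  by rewrite /P take0 /word_eval big_nil /crossings !big_geq.
have [E [-> _ lE cE]] := prefixS i.
rewrite cenM IHi cE addbF lE form_letter !prefix_lamps_offset.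
by rewrite !crossingsS addnACA [in RHS]oddD; congr (_ (+) _); rewrite oddD !oddM.
Qed.

Lemma word_problem_correct : word_problem m = 0%N <-> word_eval (lg_gen f) w = 1%g.
Proof.
have wm : (size w <= m)%N by rewrite -(size_map (fun l => (nat_of_ord l.1).*2 + nat_of_bool l.2)%N); apply: size_code.
have Pw : word_eval (lg_gen f) w = P m by rewrite /P take_oversize.
rewrite Pw; split=> [/eqP|P1].
  rewrite /word_problem !addn_eq0 -!andbA !sum_nat_seq_eq0 => /and4P[_ p0 l0 c0].
  apply: lg_ext.
  - by rewrite prefix_pos; case: (occ m m 5 =P occ m m 6) p0 => // ->; rewrite subrr.
  - apply: funext => -[s x]; apply: negbTE; apply/negP => lx.
    (* A lit lamp was toggled at a position reached by some prefix [l], and the visit test at [l]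
       detects it. *)
    have [l lm lx'] : exists2 l, (l < m)%N & pos (P l) = x.
      apply: contrapT => nl; move: lx; rewrite prefix_lamps big_nat_cond big1 //.
      move=> l /andP[lm _]; case: eqP => [E|]; last by rewrite muln0.
      by case: nl; exists l.
    have := allP l0 l; rewrite mem_index_iota => /(_ lm) /=.
    rewrite addn_eq0 !eqb0 => /andP[ot of'].
    suff : odd (visits m s l) by case: (s); rewrite ?(negbTE ot) ?(negbTE of').
    rewrite /visits; under eq_bigr do rewrite offsetE subr0 lx'.
    by rewrite -prefix_lamps.
  - apply: funext => n; apply: negbTE; apply/negP => cn.
    (* A word of length at most [m] lies in [box m], so [2 ^ n <= 2m]: the last sum reaches every
       coordinate that can be non-zero. *)
    have nm : (n < (m + m).+1)%N.
      have sw : short (lg_gens f) m (P m).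
        rewrite -Pw; exists [seq letter_eval l | l <- w]; last by rewrite size_map.
        split; last by rewrite big_map.
        move=> _ /mapP[l _ ->]; rewrite /letter_eval; case: ifP => _; last by left; exists l.1.
        by right; rewrite invgK; exists l.1.
      have [_ _ /(_ _ cn)] := short_box sw; have := ltn_expl n (ltnSn 1); lia.
    have := allP c0 n; rewrite mem_index_iota => /(_ nm) /=.
    by rewrite eqb0 -prefix_cen cn.
apply/eqP; rewrite /word_problem !addn_eq0 -!andbA !sum_nat_seq_eq0; apply/and4P; split.
- apply/allP => i _ /=; rewrite eqb0 /m /word_code code_nthE size_map; case: ltnP => // iw.
  case: w iw => // l0 w' iw; rewrite (nth_map l0) //.
  by case: (nth _ _ _) => [[i' i3] []] /=; lia.
- by have := prefix_pos m; rewrite P1 -[pos 1%g]/(0 : int); move: (occ m m 5) (occ m m 6) => a b; lia.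
- apply/allP => j _ /=; rewrite addn_eq0 !eqb0.
  have v s : odd (visits m s j) = false.
    rewrite /visits; under eq_bigr do rewrite offsetE subr0.
    by rewrite -prefix_lamps P1.
  by rewrite !v.
- by apply/allP => n _ /=; rewrite eqb0 -prefix_cen P1.
Qed.

End Word.

(** The first summand forces the entries of the decoded list below 6, so halves and parities give
    letters. *)
Lemma word_problem_valid m : word_problem m = 0%N -> exists w : word 3, word_code w = m.
Proof.
move=> /eqP; rewrite /word_problem !addn_eq0 -!andbA sum_nat_seq_eq0 => /and4P[v _ _ _].
have mE := CodeSeq.decodeK m; set s := CodeSeq.decode m in mE.
have s6 i : i \in s -> (i < 6)%N.
  move=> /(nthP 0%N)[j js <-]; have jm : (j < m)%N.
    by apply: leq_trans js _; rewrite -mE; apply: size_code.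
  have := allP v j; rewrite mem_index_iota => /(_ jm) /=.
  by rewrite -mE code_nthE js; lia.
exists [seq (inord i./2, odd i) | i <- s]; rewrite /word_code -map_comp -[RHS]mE.
congr CodeSeq.code; rewrite -[RHS]map_id; apply/eq_in_map => i /s6 i6 /=.
by rewrite inordK ?[RHS](odd_double_half i) 1?addnC; lia.
Qed.

End WordProblem.

(** * The presentation by all trivial words *)

Section Presentation.
Variables (G : groupType) (k : nat) (x : 'I_k -> G).
Local Open Scope group_scope.

Lemma word_eval_inv w : word_eval x (word_inv w) = (word_eval x w)^-1.
Proof.
rewrite /word_inv; elim: w => [|l w IHw]; first by rewrite /word_eval !big_nil invg1.
rewrite /= rev_cons -cats1 word_eval_cat IHw -(cat1s l) word_eval_cat invgM.
by congr (_ * _); rewrite /word_eval !big_seq1 /=; case: l.2; rewrite ?invgK.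
Qed.

Lemma word_eval_pair l : word_eval x [:: l; (l.1, ~~ l.2)] = 1.
Proof.
by rewrite /word_eval !big_cons big_nil mulg1 /=; case: l.2; rewrite ?mulgV ?mulVg.
Qed.

Lemma presents_kernel : generates (range x) ->
  presents [set w | word_eval x w = 1] x.
Proof.
move=> gen; split=> [g|w]; last first.
  split=> [|nc]; first exact: NCrel.
  elim: nc => {w} [w //||u v _ u1 _ v1|u _ u1|u v _ u1|u v l _|u v l _].
  - by rewrite /word_eval big_nil.
  - by rewrite word_eval_cat u1 v1 mulg1.
  - by rewrite word_eval_inv u1 invg1.
  - by rewrite !word_eval_cat u1 mul1g word_eval_inv mulgV.
  - by rewrite !word_eval_cat word_eval_pair mul1g.
  - by rewrite !word_eval_cat word_eval_pair mul1g.
have [w [Sw <-]] := gen g; elim: w Sw => [|y w IHw] Sw.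
  by exists [::]; rewrite /word_eval !big_nil.
have [v vw] := IHw (fun z zw => Sw z (mem_behead (s := y :: w) zw)).
have [l ly] : exists l, word_eval x [:: l] = y.
  case: (Sw y (mem_head _ _)) => -[i _ iy]; first by exists (i, false); rewrite /word_eval big_seq1.
  by exists (i, true); rewrite /word_eval big_seq1 /= iy invgK.
by exists (l :: v); rewrite -cat1s word_eval_cat ly vw big_cons.
Qed.

End Presentation.

Lemma lampgroup_recursively_presented f :
  computable f -> recursively_presented (lampgroup f).
Proof.
move=> fc; exists 3, [set w | word_eval (lg_gen f) w = 1%g], (lg_gen f); split; last first.
  by apply: presents_kernel; apply: lg_generates.
suff -> : [set word_code w | w in [set w | word_eval (lg_gen f) w = 1%g]] =
    [set n | word_problem f n = 0].
  exact/rec_enumerable_zero/recursive_word_problem.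
apply/seteqP; split=> [_ [w w1 <-]|n /= n0]; first exact/word_problem_correct.
have [w wn] := word_problem_valid n0; exists w => //.
by apply/(word_problem_correct f w); rewrite wn.
Qed.

(** * The trivial group, for bounded [f] *)

Lemma trivial_mulA : associative (fun _ _ : unit => tt). Proof. by []. Qed.
Lemma trivial_mul1 : left_id tt (fun _ _ => tt). Proof. by case. Qed.
Lemma trivial_1mul : right_id tt (fun _ _ => tt). Proof. by case. Qed.
Lemma trivial_mulV : @left_inverse unit unit unit tt id (fun _ _ => tt). Proof. by []. Qed.

HB.instance Definition _ := isGroup.Build unit
  trivial_mulA trivial_mul1 trivial_1mul trivial_mulV trivial_mulV.

Lemma trivial_conj_length f : simeq f (fun _ => 1) -> conj_length_simeq unit f.
Proof.
move=> [[C fC] _].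
have gen (S : set unit) : generates S.
  by case; exists [::]; split => //; rewrite big_nil.
split=> [|S finS _]; first by exists set0.
have cl n : conj_length S n = 0.
  have [[[] [[] [_ _ <-]]] _] := conj_lengthP n finS (gen S).
  apply/eqP; rewrite -leqn0.
  have [_ /(_ tt)] := @conj_distP _ S tt tt (ex_intro _ tt erefl).
  move=> /(_ erefl) /leq_trans; apply; apply/(word_norm_le (gen S)); exact: short1.
split; first by exists 0 => n; rewrite cl.
(* The conjugator length is 0, so the additive constant alone must bound [f]. *)
by exists (C + C) => n; have := fC n; lia.
Qed.

Lemma trivial_recursively_presented : recursively_presented unit.
Proof.
exists 0, [set w | word_eval (fun=> 1%g : unit) w = 1%g], (fun=> 1%g); split; last first.
  by apply: presents_kernel => -[]; exists [::]; split => //; rewrite big_nil.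
suff -> : [set word_code w | w in [set w : word 0 | word_eval (fun=> 1%g : unit) w = 1%g]] =
    [set n | n = 0].
  by apply: rec_enumerable_zero; apply: recursive_nth.
apply/seteqP; split=> [_ [[|[[]]] // _ <-]|_ ->] //.
by exists [::] => //; rewrite /word_eval /= big_nil.
Qed.

Local Close Scope classical_set_scope.

Theorem theorem1 (f : nat -> nat) (f_mono : forall m n, m <= n -> f m <= f n) :
  ((exists G : groupType, conj_length_simeq G f) <->
     (simeq f (fun _ => 1) \/ prec (fun n => n) f))
  /\
  (computable f -> simeq f (fun _ => 1) \/ prec (fun n => n) f ->
     exists G : groupType, recursively_presented G /\ conj_length_simeq G f).
Proof.
split; first split=> [[G Gf]|[f1|nf]].
- exact: conj_length_dichotomy Gf.
- by exists unit; apply: trivial_conj_length.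
- by exists (lampgroup f); apply: lg_conj_length.
move=> fc [f1|nf].
  by exists unit; split; [apply: trivial_recursively_presented | apply: trivial_conj_length].
exists (lampgroup f); split; first exact: lampgroup_recursively_presented.
exact: lg_conj_length.
Qed.
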